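(* For every $n\ge 3$ there is a positive constant $C(n)$, depending only on $n$, such that for every $R>3$ there is a complete conformal metric $g_R=e^{2f_R}\,\mathrm{eucl}$ on $\mathbb{R}^n$ whose sectional curvatures satisfy $$\sigma_-(g_R)\le C(n)\quad\text{and}\quad \int_{\mathbb{R}^n}\sigma_-(g_R)^{\frac n2}\,\mathrm{dv}_{g_R}\le C(n),$$ and such that $$\mathrm{vol}_{g_R}\left(B(o,R)\right)\ge \frac{1}{C(n)}\,R^n\left(\log R\right)^{\frac{n}{2}-1}.$$
   Context: $\mathrm{eucl}$ is the Euclidean metric on $\mathbb{R}^n$ and $f_R$ is a smooth function on $\mathbb{R}^n$. For a Riemannian metric $g$ on a manifold $M$, the function $\sigma_-(g)\colon M\to[0,\infty)$ is defined by: $\sigma_-(g)(x)=0$ if all sectional curvatures of $g$ at $x$ are nonnegative, and otherwise $-\sigma_-(g)(x)$ is the lowest sectional curvature of $g$ at $x$. $B(o,R)$ denotes the geodesic ball of the metric $g_R$ of radius $R$ centred at the origin $o$ of $\mathbb{R}^n$; $\mathrm{dv}_{g_R}$, $\mathrm{vol}_{g_R}$ are the Riemannian volume measure of $g_R$. *)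

(* Defs.v *)
From HB Require Import structures.
From mathcomp Require Import all_boot all_order all_algebra.
From mathcomp Require Import all_classical all_reals all_analysis.

Set Implicit Arguments.
Unset Strict Implicit.
Unset Printing Implicit Defensive.

Import Order.TTheory GRing.Theory Num.Theory.
Import numFieldNormedType.Exports.

Local Open Scope classical_set_scope.
Local Open Scope ring_scope.

(* Points and tangent vectors of R^n are row vectors in 'rV[R]_n. *)

(* 'rV[R]_n with the product sigma-algebra of the Borel sets of R, i.e. with the
   Borel sets of R^n; the counterpart of measurableTypeR in dimension n. *)
Definition measurableRn (R : realType) (n : nat) : Type := 'rV[R]_n.

HB.instance Definition _ (R : realType) (n : nat) :=
  Pointed.copy (measurableRn R n) 'rV[R]_n.

Section measurableRn.
Variables (R : realType) (n : nat).

Let coor (i : 'I_n) (x : measurableRn R n) : measurableTypeR R :=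
  (x : 'rV[R]_n) ord0 i.

Let Rn_set0 : g_sigma_preimage coor set0.
Proof. exact: sigma_algebra0. Qed.

Let Rn_setC A : g_sigma_preimage coor A -> g_sigma_preimage coor (~` A).
Proof. exact: sigma_algebraC. Qed.

Let Rn_bigcup (F : (set (measurableRn R n))^nat) :
  (forall i, g_sigma_preimage coor (F i)) ->
  g_sigma_preimage coor (\bigcup_i F i).
Proof. exact: sigma_algebra_bigcup. Qed.

Fact measurableRn_display : measure_display. Proof. exact. Qed.

HB.instance Definition _ := @isMeasurable.Build measurableRn_display
  (measurableRn R n) (g_sigma_preimage coor) Rn_set0 Rn_setC Rn_bigcup.

Lemma measurable_coor (i : 'I_n) : measurable_fun setT (coor i).
Proof.
move=> _ Y mY; rewrite setTI; apply: sub_sigma_algebra => /=.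
rewrite -bigcup_seq/=; exists i => /=; first by rewrite mem_index_enum.
by exists Y => //; rewrite setTI.
Qed.

Lemma measurable_fun_coor d (T : measurableType d) (f : T -> measurableRn R n) :
  (forall i, measurable_fun setT (coor i \o f)) -> measurable_fun setT f.
Proof.
move=> mf; rewrite /measurable_fun => _ A mA; rewrite setTI.
suff : g_sigma_preimage coor `<=` [set B | measurable (f @^-1` B)] by exact.
apply: smallest_sub.
  split => /= [|B mB|F mF].
  - by rewrite preimage_set0.
  - by rewrite setTD -preimage_setC; exact: measurableC.
  - by rewrite preimage_bigcup; exact: bigcup_measurable.
rewrite -bigcup_seq => B [i _] [Y mY <-] /=.
by have := mf i measurableT Y mY; rewrite !setTI.
Qed.

End measurableRn.

Definition rcons_rV (R : realType) (n : nat)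
    (p : measurableRn R n * measurableTypeR R) : measurableRn R n.+1 :=
  \row_(i < n.+1)
    if unlift ord_max i is Some j then (p.1 : 'rV[R]_n) ord0 j else p.2.

Lemma measurable_rcons_rV (R : realType) (n : nat) :
  measurable_fun setT (@rcons_rV R n).
Proof.
apply: measurable_fun_coor => i.
case: (unliftP ord_max i) => [j ij|imax].
  rewrite (_ : _ \o _ =
    (fun x : measurableRn R n => (x : 'rV[R]_n) ord0 j : measurableTypeR R)
      \o fst); last first.
    by apply/funext => p /=; rewrite mxE ij liftK.
  exact: (measurableT_comp (measurable_coor j)).
rewrite (_ : _ \o _ = snd) //.
by apply/funext => p /=; rewrite mxE imax unlift_none.
Qed.

HB.instance Definition _ (R : realType) (n : nat) :=
  @isMeasurableFun.Build _ _ _ _ (@rcons_rV R n) (@measurable_rcons_rV R n).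

Definition lebesgue_rcons (R : realType) (n : nat)
    (mu : {measure set (measurableRn R n) -> \bar R}) :
    set (measurableRn R n.+1) -> \bar R :=
  pushforward (mu \x @lebesgue_measure R)%E (@rcons_rV R n).

Section lebesgue_rcons_measure.
Variables (R : realType) (n : nat).
Variable mu : {measure set (measurableRn R n) -> \bar R}.

Let lebesgue_rcons0 : lebesgue_rcons mu set0 = 0%E.
Proof. exact: measure0. Qed.

Let lebesgue_rcons_ge0 A : (0 <= lebesgue_rcons mu A)%E.
Proof. exact: measure_ge0. Qed.

Let lebesgue_rcons_sigma_additive : semi_sigma_additive (lebesgue_rcons mu).
Proof. exact: measure_semi_sigma_additive. Qed.

HB.instance Definition _ := isMeasure.Build _ _ _ (lebesgue_rcons mu)
  lebesgue_rcons0 lebesgue_rcons_ge0 lebesgue_rcons_sigma_additive.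

End lebesgue_rcons_measure.

(* n-dimensional Lebesgue measure: the image under
   ((x_1, ..., x_(n-1)), x_n) |-> (x_1, ..., x_n) of the product of the
   (n-1)-dimensional and the one-dimensional ones *)
Fixpoint lebesgueRn (R : realType) (n : nat) :
    {measure set (measurableRn R n) -> \bar R} :=
  match n with
  | 0%N => dirac ((0 : 'rV[R]_0) : measurableRn R 0)
  | m.+1 => lebesgue_rcons (lebesgueRn R m)
  end.

Section riemannian_geometry_of_Rn.
Variables (R : realType) (n : nat).
Local Notation V := 'rV[R]_n.
Implicit Types (x y u v : V) (f : V -> R).

Definition partial (i : 'I_n) f : V -> R := 'D_(delta_mx ord0 i) f.

(* C^oo: all iterated partial derivatives exist and are continuous. *)
Definition smooth f : Prop :=
  forall s : seq 'I_n,
    continuous (foldr partial f s) /\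
    forall i x, derivable (foldr partial f s) x (delta_mx ord0 i).

(* g x i j is the coefficient g_ij of a metric tensor at the point x, in the
   standard coordinates of R^n. *)
Implicit Types g : V -> 'M[R]_n.

Definition eucl : V -> 'M[R]_n := fun=> 1%:M.

Definition conformal f : V -> 'M[R]_n := fun x => expR (2 * f x) *: eucl x.

Definition inner g x u v : R := (u *m g x *m v^T) ord0 ord0.

(* Christoffel symbol Gamma^k_ij *)
Definition christoffel g (k i j : 'I_n) x : R :=
  2^-1 * \sum_l invmx (g x) k l *
    (partial i (fun y => g y j l) x + partial j (fun y => g y i l) x
     - partial l (fun y => g y i j) x).

(* d_l-component of R(d_i, d_j) d_k, with the sign convention
   R(X, Y) Z = D_X D_Y Z - D_Y D_X Z - D_[X, Y] Z *)
Definition riemann g (l i j k : 'I_n) x : R :=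
  partial i (christoffel g l j k) x - partial j (christoffel g l i k) x
  + \sum_m (christoffel g l i m x * christoffel g m j k x
            - christoffel g l j m x * christoffel g m i k x).

Definition curvature_op g x u v (w : V) : V :=
  \row_l \sum_i \sum_j \sum_k
    riemann g l i j k x * u ord0 i * v ord0 j * w ord0 k.

Definition sectional_curvature g x u v : R :=
  inner g x (curvature_op g x u v v) u /
  (inner g x u u * inner g x v v - inner g x u v ^+ 2).

Definition sectional_curvatures g x : set R :=
  [set k | exists u v, row_free (col_mx u v) /\ k = sectional_curvature g x u v].

Definition sigma_minus g x : R :=
  if `[< forall k, sectional_curvatures g x k -> 0 <= k >] then 0
  else - inf (sectional_curvatures g x).

Definition C1 (c : R -> V) : Prop :=
  (forall t, derivable c t 1) /\ continuous (derive1 c).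

(* Piecewise C^1 on [0, 1].  Being C^1 on a closed interval is expressed as
   coinciding there with a curve that is C^1 on R; the pieces agree at their
   common endpoints, so that c is continuous on [0, 1]. *)
Definition piecewise_C1 (c : R -> V) : Prop :=
  exists2 s : seq R, itv_partition 0 1 s &
    forall i, (i < size s)%N ->
      exists2 c' : R -> V, C1 c' &
        {in `[nth 1 (0 :: s) i, nth 1 (0 :: s) i.+1], c =1 c'}.

(* derive1 c may be meaningless at the finitely many break points; this does not
   affect the integral. *)
Definition curve_length g (c : R -> V) : \bar R :=
  (\int[lebesgue_measure]_(t in `[0%R, 1%R])
     (Num.sqrt (inner g (c t) (derive1 c t) (derive1 c t)))%:E)%E.

Definition rdist g x y : \bar R :=
  ereal_inf [set curve_length g c | c in
    [set c | [/\ piecewise_C1 c, c 0 = x & c 1 = y]]].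

Definition geodesic_ball g x (r : R) : set V :=
  [set y | (rdist g x y < r%:E)%E].

Definition complete_metric g : Prop :=
  forall u : nat -> V,
    (forall e : R, 0 < e -> exists N, forall p q, (N <= p)%N -> (N <= q)%N ->
       (rdist g (u p) (u q) < e%:E)%E) ->
    exists l, forall e : R, 0 < e -> exists N, forall p, (N <= p)%N ->
       (rdist g (u p) l < e%:E)%E.

(* integral of h against the Riemannian volume dv_g = sqrt(det g) dx *)
Definition vol_integral g (A : set V) (h : V -> R) : \bar R :=
  (\int[lebesgueRn R n]_(x in A) (h x * Num.sqrt (\det (g x)))%:E)%E.

Definition volume g (A : set V) : \bar R := vol_integral g A (fun=> 1).

End riemannian_geometry_of_Rn.

(* Main.v *)
Require Import Defs.
From mathcomp Require Import all_boot all_order all_algebra.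
From mathcomp Require Import all_classical all_reals all_analysis.
From mathcomp Require Import measurable_realfun ring lra.
Import Order.TTheory GRing.Theory Num.Theory.
Import numFieldNormedType.Exports.
Local Open Scope classical_set_scope.
Local Open Scope ring_scope.

(* A flat R^n carries many spherical bubbles, each attached to it through a thin
   neck.  In a ball of radius 1 around p the factor is a function of
   w = ln (|x - p|^2 + a), namely the convex decreasing function
   w |-> - w exp (T / w) for w < 0, extended by 0, whose slope lies in [-1, 0].
   Such a factor has negative curvature only through its second derivative in w,
   which is O(1 / T): in coordinates the curvature is at least
   - C / (T |x - p|^2) on a range of T logarithmic scales, so a bubble
   contributes O(T^(1 - n/2)) to the scale invariant integral of
   sigma_minus^(n/2).  One can therefore afford about T^(n/2 - 1) bubbles.
   With a = exp (- 2 S), T = 2 S ln (4/3) and the constant S added to the factor,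
   the necks have size at least 1, a bubble has radius about exp (3 S / 2), and
   the N bubbles lie at distance O(N exp S) from the origin, which is much less
   than r = exp (3 S / 2 + K).  So the ball of radius r contains N ~ (ln r)^(n/2 - 1)
   bubbles, each of volume comparable to r^n. *)

Set Implicit Arguments.
Unset Strict Implicit.

(** * Integrals and cubes *)

Section le_ge0_integral.
Import HBNNSimple.

(* Unlike in ge0_le_integral, f and g need not be measurable: a simple function
   below f is below g. *)
Lemma le_ge0_integral d (T : measurableType d) (R : realType)
    (mu : {measure set T -> \bar R}) (A B : set T) (f g : T -> \bar R) :
  A `<=` B -> (forall x, A x -> 0 <= f x)%E -> (forall x, B x -> 0 <= g x)%E ->
  (forall x, A x -> f x <= g x)%E ->
  (\int[mu]_(x in A) f x <= \int[mu]_(x in B) g x)%E.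
Proof.
move=> AB f0 g0 fg; rewrite (integral_mkcond A) (integral_mkcond B).
have fp : forall x, (0 <= (f \_ A) x)%E by move=> x; apply: erestrict_ge0.
have gp : forall x, (0 <= (g \_ B) x)%E by move=> x; apply: erestrict_ge0.
rewrite !ge0_integralTE//; apply: ereal_sup_le => _ [h hf <-].
exists h => // x; apply: le_trans (hf x) _.
rewrite /patch; case: ifPn => [xA|_].
  by rewrite ifT ?inE; [apply: fg; rewrite -in_setE|apply: AB; rewrite -in_setE].
by case: ifPn => // xB; apply: g0; rewrite -in_setE.
Qed.

End le_ge0_integral.

(** Closed sup-norm cubes stand in for Euclidean balls: as products of intervals they have a measure
    computable by induction on the dimension. *)
Definition cube {R : realType} {n : nat} (p : 'rV[R]_n) (a : R) :
    set (measurableRn R n) :=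
  [set x : 'rV[R]_n | forall i, p ord0 i - a <= x ord0 i <= p ord0 i + a].

Lemma measurable_cube (R : realType) (n : nat) (p : 'rV[R]_n) (a : R) :
  measurable (cube p a).
Proof.
have -> : cube p a = \bigcap_(i in [set: 'I_n])
    ((fun x : measurableRn R n => (x : 'rV[R]_n) ord0 i : measurableTypeR R)
       @^-1` `[p ord0 i - a, p ord0 i + a]).
  by apply/seteqP; split => x /= h i; have := h i; rewrite /= in_itv//=; exact.
apply: fin_bigcap_measurable => // i _.
by rewrite -[X in measurable X]setTI; apply: measurable_coor.
Qed.

Lemma lebesgueRn_cube (R : realType) (n : nat) (p : 'rV[R]_n) (a : R) :
  0 <= a -> lebesgueRn R n (cube p a) = ((a *+ 2) ^+ n)%:E.
Proof.
move=> a0; elim: n p => [|n IH] p.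
  by rewrite /= diracE expr0 mem_set// => -[].
pose q : 'rV[R]_n := \row_j p ord0 (lift ord_max j).
rewrite /= /lebesgue_rcons /pushforward.
have -> : @rcons_rV R n @^-1` cube p a =
   cube q a `*` `[p ord0 ord_max - a, p ord0 ord_max + a].
  apply/seteqP; split => [[x t] /= h|[x t] /= [h1 h2] i].
    split => [j|]; last by have := h ord_max; rewrite mxE unlift_none in_itv.
    by have := h (lift ord_max j); rewrite !mxE liftK.
  rewrite mxE; case: (unliftP ord_max i) => [j ->|->].
    by have := h1 j; rewrite mxE.
  by rewrite in_itv in h2.
rewrite product_measure1E//; last exact: measurable_cube.
rewrite IH exprSr EFinM; congr (_ * _)%E.
transitivity (@lebesgue_measure R `[p ord0 ord_max - a, p ord0 ord_max + a]%classic) => //.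
rewrite lebesgue_measure_itv/= lte_fin.
(* The interval formula tests whether the left end is strictly below the right one, so the
   degenerate cube is treated apart. *)
have [a00|an0] := eqVneq a 0; first by rewrite a00 subr0 addr0 ltxx mul0rn.
rewrite ifT; last by rewrite ltrD2l; apply: (@lt_trans _ _ 0);
  rewrite ?oppr_lt0 lt_neqAle eq_sym an0.
by rewrite -EFinD; congr EFin; rewrite mulr2n; lra.
Qed.

Lemma measurable_scaled_cube (R : realType) (n : nat) (p : 'rV[R]_n) (a c : R) :
  measurable_fun setT (fun x : measurableRn R n => (c * \1_(cube p a) x)%:E).
Proof.
apply/measurable_EFinP; apply: measurable_funM; first exact: measurable_cst.
by apply: measurable_indic; exact: measurable_cube.
Qed.

Lemma integral_scaled_cube (R : realType) (n : nat) (p : 'rV[R]_n) (a c : R) :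
  0 <= a -> 0 <= c ->
  (\int[lebesgueRn R n]_x (c * \1_(cube p a) x)%:E = (c * (a *+ 2) ^+ n)%:E)%E.
Proof.
move=> a0 c0; under eq_integral do rewrite EFinM.
rewrite ge0_integralZl//; last first.
  by apply/measurable_EFinP; apply: measurable_indic; exact: measurable_cube.
by rewrite integral_indic ?setIT ?lebesgueRn_cube//; exact: measurable_cube.
Qed.

(** * Curvature of conformally flat metrics *)

(** Restriction to a line makes the one-variable chain rule available for directional
    derivatives. *)
Lemma is_derive_line (R : realType) (V : normedModType R) (f : V -> R) (x v : V) (d : R) :
  is_derive x v f d <-> is_derive (0 : R) 1 (fun h => f (h *: v + x)) d.
Proof.
have e : derive f x v = derive (fun h : R => f (h *: v + x)) (0 : R) 1.
  rewrite /derive; set g1 := fun h => h^-1 *: _; set g2 := fun h => h^-1 *: _.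
  suff -> : g1 = g2 by []; apply/funext => h /=.
  by rewrite /g1 /g2 /= addr0 scale0r add0r [h *: 1]mulr1.
split=> -[dd de]; split.
- exact: (derivable1P f x v).1 dd.
- by rewrite -e.
- exact: (derivable1P f x v).2 dd.
- by rewrite e.
Qed.

Lemma is_derive_comp1 (R : realType) (V : normedModType R) (f : V -> R) (g : R -> R)
    (x v : V) (df dg : R) :
  is_derive x v f df -> is_derive (f x) 1 g dg ->
  is_derive x v (g \o f) (dg * df).
Proof.
move=> /is_derive_line hf hg; apply/is_derive_line.
apply: (@is_derive1_comp R g (fun h => f (h *: v + x))) => //=.
by rewrite scale0r add0r.
Qed.

Lemma is_derive_unique (R : realType) (V : normedModType R) (f : V -> R) (x v : V) (d : R) :
  is_derive x v f d -> 'D_v f x = d.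
Proof. by case. Qed.

(** * Dot product and Gram determinants *)

Section dot_product.
Context {R : realType} {n : nat}.
Implicit Types u v w z : 'rV[R]_n.

Definition dot u v : R := \sum_k u ord0 k * v ord0 k.

Lemma dotC u v : dot u v = dot v u.
Proof. by apply: eq_bigr => k _; rewrite mulrC. Qed.

Lemma dotDl u v w : dot (u + v) w = dot u w + dot v w.
Proof. by rewrite -big_split; apply: eq_bigr => k _; rewrite mxE mulrDl. Qed.

Lemma dotZl a u v : dot (a *: u) v = a * dot u v.
Proof. by rewrite /dot mulr_sumr; apply: eq_bigr => k _; rewrite mxE mulrA. Qed.

Lemma dot_ge0 u : 0 <= dot u u.
Proof. by apply: sumr_ge0 => k _; rewrite -expr2 sqr_ge0. Qed.

Lemma dot_gt0 u : u != 0 -> 0 < dot u u.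
Proof.
move=> u0; rewrite lt_neqAle dot_ge0 andbT eq_sym; apply: contra u0.
rewrite psumr_eq0 => [/allP h|k _]; last by rewrite -expr2 sqr_ge0.
apply/eqP/rowP => k; rewrite mxE; apply/eqP.
by have := h k (mem_index_enum _); rewrite /= -expr2 sqrf_eq0.
Qed.

Lemma sqr_coord_le_dot u i : u ord0 i ^+ 2 <= dot u u.
Proof.
by rewrite /dot (bigD1 i)//= -expr2 lerDl sumr_ge0// => k _; rewrite -expr2 sqr_ge0.
Qed.

(** Squared area of the Euclidean parallelogram on [u] and [v]. *)
Definition gram u v : R := dot u u * dot v v - dot u v ^+ 2.

(** The vector [w] is [dot v v] times the component of [u] orthogonal to [v]; it is nonzero by
    independence and has squared length [dot v v * gram u v]. *)
Lemma row_free_gram_gt0 u v : row_free (col_mx u v) -> 0 < gram u v.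
Proof.
move=> uv.
have comb a b : a *: u + b *: v = 0 -> (a = 0) * (b = 0).
  move=> h; have /eq_row_mx[] : row_mx a%:M b%:M = row_mx 0 0 :> 'M[R]_(1, 1 + 1).
    by apply: (row_free_inj uv); rewrite row_mx0 mul0mx mul_row_col !mul_scalar_mx.
  move=> /matrixP/(_ ord0 ord0); rewrite !mxE eqxx mulr1n => ->.
  by move=> /matrixP/(_ ord0 ord0); rewrite !mxE eqxx mulr1n => ->.
have v0 : v != 0.
  apply/eqP => v0; have /comb[_ /eqP] : 0 *: u + 1 *: v = 0.
    by rewrite v0 scaler0 scale0r addr0.
  by rewrite oner_eq0.
pose w := dot v v *: u + (- dot u v) *: v.
have w0 : w != 0.
  apply/eqP => /comb[/eqP]; rewrite (gt_eqF (dot_gt0 v0)) => //.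
have := dot_gt0 w0.
have -> : dot w w = dot v v * gram u v.
  rewrite /w /gram !dotDl !dotZl dotC (dotC v) !dotDl !dotZl (dotC v u).
  by ring.
by rewrite pmulr_rgt0// dot_gt0.
Qed.

(** Squared length of [dot z u *: v - dot z v *: u]; for independent [u], [v] it is [gram u v] times
    the squared length of the projection of [z] to their plane. *)
Definition gram3 z u v : R := dot z u ^+ 2 * dot v v + dot z v ^+ 2 * dot u u
  - 2 * dot z u * dot z v * dot u v.

(** Projection does not increase length: [y] is [gram u v] times the component of [z] orthogonal to
    the plane, and [0 <= dot y y] is the claim up to the factor [gram u v]. *)
Lemma gram3_le z u v : 0 < gram u v -> gram3 z u v <= dot z z * gram u v.
Proof.
move=> W0.
pose a := dot z u * dot v v - dot z v * dot u v.
pose b := dot z v * dot u u - dot z u * dot u v.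
pose y := gram u v *: z + ((- a) *: u + (- b) *: v).
have : 0 <= gram u v * (dot z z * gram u v - gram3 z u v).
  rewrite (_ : _ * _ = dot y y) ?dot_ge0// /y.
  rewrite !dotDl !dotZl (dotC z (_ + _)) (dotC u (_ + _)) (dotC v (_ + _)).
  rewrite !dotDl !dotZl (dotC u z) (dotC v z) (dotC v u).
  by rewrite /a /b /gram3 /gram; ring.
by rewrite pmulr_rge0// subr_ge0.
Qed.

End dot_product.

Section conformal_curvature.
Context {R : realType} {n : nat}.
Local Notation V := 'rV[R]_n.
(** [hf i j] is the derivative of [df j] along axis [i]. With gradient and Hessian as data, the
    curvature formulas can be fed with explicit derivatives. *)
Variables (f : V -> R) (df : 'I_n -> V -> R) (hf : 'I_n -> 'I_n -> V -> R).
Local Notation e i := (delta_mx ord0 i : V).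
Hypothesis fE : forall i x, is_derive x (e i) f (df i x).
Hypothesis dfE : forall i j x, is_derive x (e i) (df j) (hf i j x).
Local Notation d i j := ((i == j)%:R : R).

Lemma sum_delta (i : 'I_n) (g : 'I_n -> R) : \sum_k d i k * g k = g i.
Proof.
rewrite (bigD1 i)//= eqxx mul1r big1 ?addr0// => k ki.
by rewrite eq_sym (negbTE ki) mul0r.
Qed.

Lemma sum_lin3 (c1 c2 c3 : R) (X Y Z : 'I_n -> R) :
  \sum_k (c1 * X k + c2 * Y k + c3 * Z k) =
  c1 * (\sum_k X k) + c2 * (\sum_k Y k) + c3 * (\sum_k Z k).
Proof. by rewrite !big_split/= -!mulr_sumr. Qed.

Lemma conformalE x i j : conformal f x i j = expR (2 * f x) * d i j.
Proof. by rewrite /conformal /eucl !mxE. Qed.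

Lemma inner_conformal x u v : inner (conformal f) x u v = expR (2 * f x) * dot u v.
Proof.
rewrite /inner /conformal /eucl -scalemxAr mulmx1 -scalemxAl mxE; congr (_ * _).
by rewrite mxE; apply: eq_bigr => k _; rewrite mxE.
Qed.

Lemma partial_conformal i j l x :
  partial i (fun y => conformal f y j l) x =
  2 * df i x * expR (2 * f x) * d j l.
Proof.
apply: is_derive_unique.
rewrite (_ : (fun y => _) = (d j l) *: ((expR \o ( *%R 2)) \o f)); last first.
  by apply/funext => y; rewrite conformalE /= mulrC.
rewrite (_ : 2 * _ * _ * _ = d j l *: (expR (2 * f x) * 2 * df i x)); last first.
  by rewrite /GRing.scale/=; ring.
apply: is_deriveZ.
apply: (@is_derive_comp1 _ _ f (expR \o *%R 2) _ _ _ (expR (2 * f x) * 2)).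
apply: is_derive1_comp.
by rewrite -[X in is_derive _ _ _ X]mulr1; exact: is_deriveZ.
Qed.

Lemma christoffel_conformal k i j x : christoffel (conformal f) k i j x =
  d k i * df j x + d k j * df i x - d i j * df k x.
Proof.
rewrite /christoffel.
have -> : invmx (conformal f x) = (expR (2 * f x))^-1%:M.
  by rewrite /conformal /eucl scalemx1 invmx_scalar.
rewrite (eq_bigr (fun l => d k l * (2 * (d j l * df i x + d i l * df j x
    - d i j * df l x)))) => [|l _].
  by rewrite sum_delta mulKf ?pnatr_eq0// (eq_sym j) (eq_sym i); ring.
rewrite !partial_conformal mxE -[X in X * _]mulr_natr.
have := expR_gt0 (2 * f x); set E := expR _ => E0.
by field; rewrite gt_eqF.
Qed.

(** Up to sign and order of indices, this is the Kulkarni-Nomizu product of the identity with Hess f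
    - df df^T + |df|^2 / 2. The exponential weight cancels because one index is raised; symmetry of
    the Hessian removes the second-derivative term with [d l k]. *)
Lemma riemann_conformal l i j k x :
  let s := \sum_m df m x ^+ 2 in
  hf i j x = hf j i x ->
  riemann (conformal f) l i j k x =
  d l j * (hf i k x - df i x * df k x) - d l i * (hf j k x - df j x * df k x)
  + d i k * (hf j l x - df j x * df l x) - d j k * (hf i l x - df i x * df l x)
  + s * (d l j * d i k - d l i * d j k).
Proof.
move=> s hs; rewrite /riemann.
have D i' j' : partial i' (christoffel (conformal f) l j' k) x =
    d l j' * hf i' k x + d l k * hf i' j' x - d j' k * hf i' l x.
  apply: is_derive_unique.
  rewrite (_ : christoffel _ _ _ _ =
    d l j' *: df k + d l k *: df j' - d j' k *: df l); last first.
    by apply/funext => y; rewrite christoffel_conformal.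
  exact: (is_deriveB (is_deriveD (is_deriveZ _ (dfE i' k x)) (is_deriveZ _ (dfE i' j' x)))
    (is_deriveZ _ (dfE i' l x))).
have G i' j' : \sum_m christoffel (conformal f) l i' m x *
      christoffel (conformal f) m j' k x =
    d l i' * (2 * df j' x * df k x - d j' k * s)
    + df i' x * (d l j' * df k x + d l k * df j' x - d j' k * df l x)
    - df l x * (d i' j' * df k x + d i' k * df j' x - d j' k * df i' x).
  rewrite (eq_bigr (fun m =>
      d l i' * (d j' m * (df m x * df k x) + d k m * (df m x * df j' x)
                - d j' k * df m x ^+ 2)
      + df i' x * (d l m * (d m j' * df k x + d m k * df j' x - d j' k * df m x))
      - df l x * (d i' m * (d m j' * df k x + d m k * df j' x - d j' k * df m x)))) => [|m _].
    rewrite sumrB big_split/= -!mulr_sumr !sum_delta sumrB big_split/= !sum_delta.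
    by rewrite -mulr_sumr -/s; ring.
  by rewrite !christoffel_conformal (eq_sym j' m) (eq_sym k m); ring.
rewrite !D sumrB !G hs (eq_sym j i); ring.
Qed.

(** For a function of |x - p|^2, gradient and Hessian have this form with z = x - p, and the
    curvature reduces to two Gram quantities. *)
Lemma conformal_curvature_contraction x (z : V) (A B : R) (u v : V) :
  (forall i, df i x = A * z ord0 i) ->
  (forall i j, hf i j x = A * d i j + B * z ord0 i * z ord0 j) ->
  \sum_l u ord0 l * (\sum_i \sum_j \sum_k
     riemann (conformal f) l i j k x * u ord0 i * v ord0 j * v ord0 k) =
  - (2 * A + A ^+ 2 * dot z z) * gram u v + (A ^+ 2 - B) * gram3 z u v.
Proof.
move=> fx hx.
set G := B - A ^+ 2; set s := 2 * A + A ^+ 2 * dot z z.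
have Rx l i j k : riemann (conformal f) l i j k x =
    s * (d l j * d i k - d l i * d j k) +
    G * (d l j * z ord0 i * z ord0 k - d l i * z ord0 j * z ord0 k
         + d i k * z ord0 j * z ord0 l - d j k * z ord0 i * z ord0 l).
  rewrite riemann_conformal; last by rewrite !hx (eq_sym i j); ring.
  rewrite !hx !fx (_ : \sum_m _ = A ^+ 2 * dot z z).
    by rewrite /s /G (eq_sym j l) (eq_sym i l); ring.
  by rewrite mulr_sumr; apply: eq_bigr => m _; rewrite fx; ring.
(* The indices k, j, i, l are summed in turn. Each summand is first put in the form of [sum_lin3],
   with coefficients free of the summation index. *)
have step l i j : \sum_k riemann (conformal f) l i j k x * u ord0 i * v ord0 j * v ord0 k
    = u ord0 i * v ord0 j *
     (s * (d l j * v ord0 i - d l i * v ord0 j) +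
      G * (d l j * z ord0 i * dot z v - d l i * z ord0 j * dot z v
         + v ord0 i * z ord0 j * z ord0 l - v ord0 j * z ord0 i * z ord0 l)).
  rewrite (eq_bigr (fun k => (u ord0 i * v ord0 j * (s * d l j + G * z ord0 j * z ord0 l)) *
      (d i k * v ord0 k) +
     (- (u ord0 i * v ord0 j * (s * d l i + G * z ord0 i * z ord0 l))) * (d j k * v ord0 k) +
     (u ord0 i * v ord0 j * G * (d l j * z ord0 i - d l i * z ord0 j)) * (z ord0 k * v ord0 k))).
    by rewrite sum_lin3 !sum_delta -/(dot z v); ring.
  by move=> k _; rewrite Rx; ring.
have step2 l i : \sum_j \sum_k riemann (conformal f) l i j k x * u ord0 i * v ord0 j * v ord0 k
    = u ord0 i *
     (s * (v ord0 l * v ord0 i - d l i * dot v v) +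
      G * (v ord0 l * z ord0 i * dot z v - d l i * dot z v ^+ 2
         + v ord0 i * dot z v * z ord0 l - dot v v * z ord0 i * z ord0 l)).
  under eq_bigr do rewrite step.
  rewrite (eq_bigr (fun j => (u ord0 i * (s * v ord0 i + G * z ord0 i * dot z v)) *
      (d l j * v ord0 j) +
     (- (u ord0 i * (s * d l i + G * z ord0 i * z ord0 l))) * (v ord0 j * v ord0 j) +
     (u ord0 i * G * (v ord0 i * z ord0 l - d l i * dot z v)) * (z ord0 j * v ord0 j))).
    by rewrite sum_lin3 !sum_delta -/(dot z v) -/(dot v v); ring.
  by move=> j _; ring.
have step3 l : \sum_i \sum_j \sum_k riemann (conformal f) l i j k x * u ord0 i * v ord0 j * v ord0 k
    = s * (v ord0 l * dot u v - u ord0 l * dot v v) +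
      G * (v ord0 l * dot z u * dot z v - u ord0 l * dot z v ^+ 2
         + dot u v * dot z v * z ord0 l - dot v v * dot z u * z ord0 l).
  under eq_bigr do rewrite step2.
  rewrite (eq_bigr (fun i => (s * v ord0 l + G * dot z v * z ord0 l) * (u ord0 i * v ord0 i) +
     (- (s * dot v v + G * dot z v ^+ 2)) * (d l i * u ord0 i) +
     G * (v ord0 l * dot z v - dot v v * z ord0 l) * (z ord0 i * u ord0 i))).
    by rewrite sum_lin3 !sum_delta -/(dot z u) -/(dot u v); ring.
  by move=> i _; ring.
under eq_bigr do rewrite step3.
rewrite (eq_bigr (fun l => (s * dot u v + G * dot z u * dot z v) * (u ord0 l * v ord0 l) +
   (- (s * dot v v + G * dot z v ^+ 2)) * (u ord0 l * u ord0 l) +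
   G * (dot u v * dot z v - dot v v * dot z u) * (z ord0 l * u ord0 l))).
  by rewrite sum_lin3 -/(dot u v) -/(dot z u) -/(dot u u) /gram /gram3 /s /G; ring.
by move=> l _; ring.
Qed.

(** Up to the conformal weight the curvature is - (2 A + A^2 |z|^2) - (B - A^2) gram3 / gram. As A^2
    <= B, [gram3_le] bounds it below by - (2 A + B |z|^2). *)
Lemma sectional_curvature_ge x (z : V) (A B k : R) (u v : V) :
  (forall i, df i x = A * z ord0 i) ->
  (forall i j, hf i j x = A * d i j + B * z ord0 i * z ord0 j) ->
  A ^+ 2 <= B -> 2 * A + B * dot z z <= k -> row_free (col_mx u v) ->
  - (k * expR (- (2 * f x))) <= sectional_curvature (conformal f) x u v.
Proof.
move=> fx hx AB ABk /row_free_gram_gt0 W0; rewrite /sectional_curvature !inner_conformal.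
have -> : dot (curvature_op (conformal f) x u v v) u =
    - (2 * A + A ^+ 2 * dot z z) * gram u v + (A ^+ 2 - B) * gram3 z u v.
  rewrite -(conformal_curvature_contraction _ _ fx hx) dotC.
  by apply: eq_bigr => l _; rewrite mxE.
have E0 := expR_gt0 (2 * f x); rewrite expRN.
set E := expR _ in E0 *; set Q := (X in E * X).
have -> : E * Q / (E * dot u u * (E * dot v v) - (E * dot u v) ^+ 2) = (Q / gram u v) / E.
  have -> : E * dot u u * (E * dot v v) - (E * dot u v) ^+ 2 = E * E * gram u v.
    by rewrite /gram; ring.
  by field; rewrite !gt_eqF.
rewrite -mulNr ler_pM2r ?invr_gt0// ler_pdivlMr//.
have := gram3_le z W0; move: (gram u v) W0 (gram3 z u v) @Q => W W0 P /= Pq.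
have : (A ^+ 2 - B) * (dot z z * W) <= (A ^+ 2 - B) * P by rewrite ler_wnM2l// subr_le0.
have : (2 * A + B * dot z z) * W <= k * W by rewrite ler_wpM2r// ltW.
nra.
Qed.

Lemma sigma_minus_conformal_le x (z : V) (A B k : R) :
  (forall i, df i x = A * z ord0 i) ->
  (forall i j, hf i j x = A * d i j + B * z ord0 i * z ord0 j) ->
  A ^+ 2 <= B -> 2 * A + B * dot z z <= k -> 0 <= k ->
  sigma_minus (conformal f) x <= k * expR (- (2 * f x)).
Proof.
move=> fx hx AB ABk k0; rewrite /sigma_minus; case: asboolP => [_|/existsNP[c /not_implyP[cK _]]].
  by rewrite mulr_ge0// expR_ge0.
(* The negative curvature [c] shows that the set of curvatures is nonempty, as a lower bound on
   [inf] requires. *)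
rewrite lerNl; apply: lb_le_inf; first by exists c.
by move=> _ [u [v [uv ->]]]; exact: (sectional_curvature_ge fx hx AB ABk uv).
Qed.

End conformal_curvature.

Lemma sigma_minus_ge0 {R : realType} {n : nat} (g : 'rV[R]_n -> 'M[R]_n) x :
  0 <= sigma_minus g x.
Proof.
rewrite /sigma_minus; case: asboolP => // /existsNP[c /not_implyP[cK /negP]].
rewrite -ltNge oppr_ge0 => c0.
have [lb|nlb] := pselect (has_lbound (sectional_curvatures g x)).
  by apply: le_trans (ltW c0); exact: ge_inf.
(* For a set without lower bound [inf] takes the default value 0. *)
by rewrite inf_out// => -[].
Qed.

(** * The bubble profile *)

(** For use at w = 0, where the two formulas defining [flat] meet: the difference quotient there is
    at most C |h|. *)
Lemma is_derive_quadratic0 (R : realType) (f : R -> R) (C : R) :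
  f 0 = 0 -> (forall h, `|f h| <= C * h ^+ 2) -> is_derive (0 : R) 1 f 0.
Proof.
move=> f0 fC.
have C0 : 0 <= C by have := fC 1; rewrite expr1n mulr1; exact: le_trans.
have cv : (fun h : R => h^-1 *: ((f \o shift 0) (h *: (1 : R)) - f 0)) @ (0 : R)^' --> (0 : R).
  apply/cvgr0Pnorm_lt => e e0; near=> h.
  have h0 : h != 0 by near: h; exact: nbhs_dnbhs_neq.
  rewrite /= addr0 [h *: 1]mulr1 f0 subr0 normrM normfV.
  have hp : 0 < `|h| by rewrite normr_gt0.
  rewrite mulrC ltr_pdivrMr//; apply: (le_lt_trans (fC h)).
  rewrite -real_normK ?num_real// expr2 mulrA ltr_pM2r//.
  have : `|h| < e / (C + 1).
    by near: h; apply: dnbhs0_lt; rewrite divr_gt0// ltr_wpDl.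
  rewrite ltr_pdivlMr ?ltr_wpDl//; apply: le_lt_trans.
  by rewrite mulrDr mulr1 mulrC lerDl ltW.
split; first by apply/cvg_ex; exists 0.
exact: cvg_lim cv.
Unshelve. all: by end_near. Qed.

Section flat.
Context {R : realType}.
Implicit Types (T w : R) (k : nat).

(** The powers of 1 / w make the family closed under differentiation: all derivatives of the profile
    are constant combinations of its members. *)
Definition flat T k w : R := if w < 0 then w^-1 ^+ k * expR (T / w) else 0.

Lemma expR_ge_pow (y : R) k : 0 <= y -> y ^+ k.+1 <= (k.+1)`!%:R * expR y.
Proof.
move=> y0; have := expR_ge1Dxn k y0.
have f0 : 0 < (k.+1)`!%:R :> R by rewrite ltr0n fact_gt0.
rewrite -(ler_pM2l f0); apply: le_trans.
by rewrite mulrDr mulrCA divff ?gt_eqF// !mulr1 lerDr ltW.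
Qed.

(** With y = - 1 / w, the term of order k + 2 of the series of exp (T y) absorbs the factor y^k and
    the two further powers matching w^2. *)
Lemma flat_quadratic T k : 0 < T ->
  exists C, forall w, `|flat T k w| <= C * w ^+ 2.
Proof.
move=> T0; exists ((k.+2)`!%:R / T ^+ k.+2) => w.
have C0 : 0 <= (k.+2)`!%:R / T ^+ k.+2 :> R.
  by rewrite divr_ge0// exprn_ge0// ltW.
rewrite /flat; case: ifPn => w0; last by rewrite normr0 mulr_ge0// sqr_ge0.
pose y := - w^-1; have y0 : 0 < y by rewrite oppr_gt0 invr_lt0.
have -> : T / w = - (T * y) by rewrite /y mulrN opprK.
have -> : w ^+ 2 = (y ^+ 2)^-1 by rewrite /y sqrrN exprVn invrK.
rewrite normrM normrX -normrN -/y (gtr0_norm y0) gtr0_norm ?expR_gt0//.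
rewrite expRN ler_pdivrMr ?expR_gt0// mulrAC ler_pdivlMr ?exprn_gt0//.
rewrite -exprD addn2 mulrAC ler_pdivlMr ?exprn_gt0// -exprMn [y * T]mulrC.
by apply: expR_ge_pow; rewrite mulr_ge0// ltW.
Qed.

Lemma is_derive_flat T k w : 0 < T ->
  is_derive w 1 (flat T k) (- k%:R * flat T k.+1 w - T * flat T k.+2 w).
Proof.
move=> T0; have [w0|w0|->] := ltgtP w 0.
- have e : \near w, w^-1 ^+ k * expR (T / w) = flat T k w.
    near=> z; rewrite /flat ifT//; near: z; exact: lt_nbhsl.
  apply: (near_eq_is_derive e); rewrite /flat w0.
  have di : is_derive w 1 (fun z : R => z^-1) (- (w^-1 ^+ 2)).
    rewrite -[X in is_derive _ _ _ X]mulr1 exprVn.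
    by apply: (@is_deriveV R id w 1 1); rewrite lt_eqF.
  have dk : is_derive w 1 (fun z : R => z^-1 ^+ k) (- k%:R * w^-1 ^+ k.+1).
    have := is_deriveX k di; rewrite exprfctE => dk.
    apply: (is_derive_eq dk).
    by case: (k) => [|j] /=; rewrite /GRing.scale/= ?exprS; ring.
  have de : is_derive w 1 (fun z : R => expR (T / z)) (- (T * w^-1 ^+ 2 * expR (T / w))).
    have dT : is_derive w 1 (fun z : R => T / z) (T * - (w^-1 ^+ 2)).
      exact: (is_deriveZ T).
    have := is_derive_comp1 dT (is_derive_expR (T / w)).
    by rewrite mulrN mulrN mulrC.
  apply: (is_derive_eq (is_deriveM dk de)).
  by rewrite /GRing.scale/= !exprS expr0; ring.
- have e : \near w, cst 0 w = flat T k w.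
    near=> z; rewrite /flat ifF//; apply/negbTE; rewrite -leNgt ltW//.
    by near: z; exact: lt_nbhsr.
  apply: (near_eq_is_derive e); rewrite /flat ltNge ltW//= !mulr0 subr0.
  exact: is_derive_cst.
- rewrite {2 3}/flat ltxx !mulr0 subr0.
  have [C fC] := flat_quadratic k T0; apply: is_derive_quadratic0 fC.
  by rewrite /flat ltxx.
Unshelve. all: by end_near. Qed.

Definition profile T w : R := - (w * flat T 0 w).

Lemma flatS T k w : w * flat T k.+1 w = flat T k w.
Proof.
rewrite /flat; case: ifP => w0; last by rewrite mulr0.
by rewrite exprS mulrA mulrA divff ?mul1r// lt_eqF.
Qed.

Lemma is_derive_profile T w : 0 < T ->
  is_derive w 1 (profile T) (T * flat T 1 w - flat T 0 w).
Proof.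
move=> T0; have fd := is_derive_flat 0 w T0.
rewrite (_ : profile T = - (id * flat T 0)) //.
rewrite (_ : _ - _ = - (w *: (- 0%:R * flat T 1 w - T * flat T 2 w) + flat T 0 w *: 1)); last first.
  by rewrite -(flatS T 1) /GRing.scale/=; ring.
exact: is_deriveN.
Qed.

Lemma is_derive_profile2 T w : 0 < T ->
  is_derive w 1 (fun w => T * flat T 1 w - flat T 0 w) (- T ^+ 2 * flat T 3 w).
Proof.
move=> T0; have fd := is_derive_flat 0 w T0; have fd1 := is_derive_flat 1 w T0.
rewrite (_ : (fun w => _) = T *: flat T 1 - flat T 0) //.
rewrite (_ : _ * _ = T *: (- 1%:R * flat T 2 w - T * flat T 3 w) -
   (- 0%:R * flat T 1 w - T * flat T 2 w)); last by rewrite /GRing.scale/=; ring.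
exact: is_deriveB.
Qed.

(** In terms of y = - T / w > 0 the slope is - (1 + y) exp (- y), and exp y >= 1 + y. *)
Lemma profile_slope T w : 0 < T -> -1 <= T * flat T 1 w - flat T 0 w <= 0.
Proof.
move=> T0; rewrite /flat; case: ifPn => w0; last by rewrite mulr0 subr0 lexx lerN10.
pose y := - (T / w); have y0 : 0 < y by rewrite oppr_gt0 pmulr_rlt0// invr_lt0.
have -> : T * (w^-1 ^+ 1 * expR (T / w)) - w^-1 ^+ 0 * expR (T / w) = - ((1 + y) / expR y).
  by rewrite -expRN /y opprK expr1 expr0; ring.
rewrite lerN2 oppr_le0 ler_pdivrMr ?expR_gt0// mul1r expR_ge1Dx/=.
by rewrite divr_ge0 ?expR_ge0// addr_ge0// ltW.
Qed.

(** In terms of y = - T / w the second derivative is y^3 exp (- y) / T, and y^3 <= 3! exp y. *)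
Lemma profile_convex T w : 0 < T -> 0 <= - T ^+ 2 * flat T 3 w <= 6 / T.
Proof.
move=> T0; rewrite /flat; case: ifPn => w0; last first.
  by rewrite mulr0 lexx divr_ge0// ltW.
pose y := - (T / w); have y0 : 0 < y by rewrite oppr_gt0 pmulr_rlt0// invr_lt0.
have -> : - T ^+ 2 * (w^-1 ^+ 3 * expR (T / w)) = y ^+ 3 / expR y / T.
  by rewrite -expRN /y opprK; field; rewrite gt_eqF// lt_eqF.
rewrite divr_ge0 ?(ltW T0)//= ?divr_ge0 ?expR_ge0 ?exprn_ge0 ?(ltW y0)//.
rewrite ler_pM2r ?invr_gt0// ler_pdivrMr ?expR_gt0//.
exact: (expR_ge_pow 2 (ltW y0)).
Qed.

Lemma profile_ge0 T w : 0 <= profile T w.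
Proof.
rewrite /profile /flat; case: ifPn => w0; last by rewrite mulr0 oppr0.
by rewrite -mulNr mulr_ge0 ?oppr_ge0 ?(ltW w0)// expr0 mul1r expR_ge0.
Qed.

Lemma profile_eq0 T w : 0 <= w -> profile T w = 0.
Proof. by move=> w0; rewrite /profile /flat ltNge w0 mulr0 oppr0. Qed.

End flat.

(** * Smoothness and derivatives of a bubble *)

Section bubble.
Context {R : realType} {n : nat}.
Local Notation V := 'rV[R]_n.
Local Notation e i := (delta_mx ord0 i : V).
Local Notation d i j := ((i == j)%:R : R).
Variables (T a : R).
Hypotheses (T0 : 0 < T) (a0 : 0 < a).
Implicit Types (x p : V).

Definition rho p x : R := dot (x - p) (x - p) + a.

Lemma rho_gt0 p x : 0 < rho p x.
Proof. by rewrite ltr_wpDl// dot_ge0. Qed.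

Lemma is_derive_coord (i j : 'I_n) x :
  is_derive x (e i) (fun y : V => y ord0 j) (d i j).
Proof.
apply/is_derive_line.
rewrite (_ : (fun h => _) = d i j *: (@id R) + cst (x ord0 j)); last first.
  by apply/funext => h; rewrite !mxE eqxx/= eq_sym [RHS]addrC addrC mulrC.
rewrite -[X in is_derive _ _ _ X]addr0 -[X in is_derive _ _ _ (X + _)]mulr1.
exact: is_deriveD.
Qed.

Lemma rhoE p : rho p = \sum_(k < n) ((fun x => x ord0 k) - cst (p ord0 k)) ^+ 2 + cst a.
Proof.
apply/funext => x; rewrite /rho /dot /= fct_sumE; congr (_ + _).
by apply: eq_bigr => k _; rewrite !mxE -expr2.
Qed.

Lemma differentiable_rho p x : differentiable (rho p) x.
Proof.
rewrite rhoE; apply: differentiableD => //; apply: differentiable_sum => k.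
apply: differentiableX; apply: differentiableB => //.
exact: differentiable_coord.
Qed.

Lemma is_derive_rho p x i : is_derive x (e i) (rho p) (2 * (x - p) ord0 i).
Proof.
have hd k := is_derive_coord i k x.
rewrite rhoE; apply: is_derive_eq.
rewrite addr0 (bigD1 i)//= big1 => [|k ki].
  by rewrite eqxx subr0 addr0 !mxE /GRing.scale/= mulr1.
by rewrite eq_sym (negbTE ki) subr0 scaler0.
Qed.


Lemma is_derive_ln_rho p x i : is_derive x (e i) (fun y => ln (rho p y))
  ((rho p x)^-1 * (2 * (x - p) ord0 i)).
Proof.
exact: is_derive_comp1 (is_derive_rho p x i) (is_derive1_ln (rho_gt0 p x)).
Qed.

Lemma is_derive_rhoV p x i : is_derive x (e i) (fun y => (rho p y)^-1)
  (- ((rho p x)^-1 * (rho p x)^-1) * (2 * (x - p) ord0 i)).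
Proof.
have hV : is_derive (rho p x) 1 (fun y : R => y^-1) (- ((rho p x)^-1 * (rho p x)^-1)).
  rewrite -[X in is_derive _ _ _ X]mulr1 -expr2 exprVn.
  by apply: (@is_deriveV R id (rho p x) 1 1); rewrite gt_eqF ?rho_gt0.
exact: is_derive_comp1 (is_derive_rho p x i) hV.
Qed.

Lemma is_derive_flat_rho p k x i :
  is_derive x (e i) (fun y => flat T k (ln (rho p y)))
  ((- k%:R * flat T k.+1 (ln (rho p x)) - T * flat T k.+2 (ln (rho p x)))
   * ((rho p x)^-1 * (2 * (x - p) ord0 i))).
Proof. exact: is_derive_comp1 (is_derive_ln_rho p x i) (is_derive_flat _ _ T0). Qed.

(* A class of differentiable functions closed under partial derivatives. *)
Inductive elementary : (V -> R) -> Prop :=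
| elementary_cst c : elementary (fun=> c)
| elementary_coord i : elementary (fun x => x ord0 i)
| elementary_ln p : elementary (fun x => ln (rho p x))
| elementary_rhoV p : elementary (fun x => (rho p x)^-1)
| elementary_flat p k : elementary (fun x => flat T k (ln (rho p x)))
| elementary_add f g : elementary f -> elementary g -> elementary (fun x => f x + g x)
| elementary_mul f g : elementary f -> elementary g -> elementary (fun x => f x * g x).

Lemma differentiable_comp1 (f : V -> R) (g : R -> R) x dg :
  differentiable f x -> is_derive (f x) 1 g dg -> differentiable (fun y => g (f y)) x.
Proof.
move=> df [dg1 _]; apply: differentiable_comp => //.
exact/derivable1_diffP.
Qed.

Lemma elementary_differentiable f x : elementary f -> differentiable f x.
Proof.
have dln p : differentiable (fun y => ln (rho p y)) x.
  exact: differentiable_comp1 (differentiable_rho p x) (is_derive1_ln (rho_gt0 p x)).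
elim=> {f} [c|i|p|p|p k|f g _ df _ dg|f g _ df _ dg].
- exact: differentiable_cst.
- exact: differentiable_coord.
- exact: dln.
- by apply: differentiableV; rewrite ?gt_eqF ?rho_gt0//; exact: differentiable_rho.
- exact: differentiable_comp1 (dln p) (is_derive_flat k _ T0).
- exact: differentiableD.
- exact: differentiableM.
Qed.

Lemma elementary_partial f i : elementary f -> elementary (partial i f).
Proof.
have linear p : elementary (fun x => 2 * (x - p) ord0 i).
  rewrite (_ : (fun x => _) = fun x : V => 2 * (x ord0 i + - p ord0 i)).
    apply: elementary_mul; first exact: elementary_cst.
    by apply: elementary_add; [exact: elementary_coord|exact: elementary_cst].
  by apply/funext => x; rewrite !mxE.
have pE g dg : (forall x, is_derive x (e i) g (dg x)) -> elementary dg ->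
    elementary (partial i g).
  move=> h hg; rewrite (_ : partial i g = dg)//.
  by apply/funext => x; apply: is_derive_unique.
elim=> {f} [c|j|p|p|p k|f g ef df eg dg|f g ef df eg dg].
- by apply: (pE _ (fun=> 0)); exact: elementary_cst.
- apply: (pE _ (fun=> d i j)) => [x|]; last exact: elementary_cst.
  exact: is_derive_coord.
- apply: pE => [x|]; first exact: is_derive_ln_rho.
  by apply: elementary_mul => //; exact: elementary_rhoV.
- apply: pE => [x|]; first exact: is_derive_rhoV.
  apply: elementary_mul => //.
  rewrite (_ : (fun x => _) = fun x => -1 * ((rho p x)^-1 * (rho p x)^-1)).
    apply: elementary_mul; first exact: elementary_cst.
    by apply: elementary_mul; exact: elementary_rhoV.
  by apply/funext => x; rewrite mulN1r.
- apply: pE => [x|]; first exact: is_derive_flat_rho.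
  apply: elementary_mul; last by apply: elementary_mul => //; exact: elementary_rhoV.
  rewrite (_ : (fun x => _) = fun x => - k%:R * flat T k.+1 (ln (rho p x)) +
     - T * flat T k.+2 (ln (rho p x))).
    by apply: elementary_add; apply: elementary_mul;
      [exact: elementary_cst|exact: elementary_flat|exact: elementary_cst|exact: elementary_flat].
  by apply/funext => x; rewrite !mulNr.
- apply: (pE _ (fun x => partial i f x + partial i g x)) => [x|]; last exact: elementary_add.
  by apply: is_deriveD; apply/derivableP/diff_derivable/elementary_differentiable.
- apply: (pE _ (fun x => f x * partial i g x + g x * partial i f x)) => [x|].
    by apply: is_deriveM; apply/derivableP/diff_derivable/elementary_differentiable.
  by apply: elementary_add; apply: elementary_mul.
Qed.

Lemma elementary_smooth f : elementary f -> smooth f.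
Proof.
move=> ef s; have es : elementary (foldr (@partial R n) f s).
  by elim: s => //= i s; exact: elementary_partial.
split=> [x|i x]; first exact/differentiable_continuous/elementary_differentiable.
exact/diff_derivable/elementary_differentiable.
Qed.

Definition bubble p x : R := profile T (ln (rho p x)).

(** [slope] and [bend] are the first and second derivatives of the profile, taken at w = ln rho. *)
Definition slope p x : R := T * flat T 1 (ln (rho p x)) - flat T 0 (ln (rho p x)).

Definition bend p x : R := - T ^+ 2 * flat T 3 (ln (rho p x)).

Lemma elementary_bubble p : elementary (bubble p).
Proof.
rewrite (_ : bubble p = fun x => -1 * (ln (rho p x) * flat T 0 (ln (rho p x)))).
  apply: elementary_mul; first exact: elementary_cst.
  by apply: elementary_mul; [exact: elementary_ln|exact: elementary_flat].
by apply/funext => x; rewrite mulN1r.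
Qed.

Lemma is_derive_bubble p x i :
  is_derive x (e i) (bubble p) (2 * slope p x / rho p x * (x - p) ord0 i).
Proof.
apply: (is_derive_eq (is_derive_comp1 (is_derive_ln_rho p x i) (is_derive_profile _ T0))).
by rewrite /slope; ring.
Qed.

(** Gradient and Hessian have the radial form A z and A id + B z z^T, with A = 2 slope / rho and B =
    4 (bend - slope) / rho^2. *)
Lemma is_derive_bubble2 p x i j :
  is_derive x (e i) (fun y => 2 * slope p y / rho p y * (y - p) ord0 j)
    (2 * slope p x / rho p x * d i j +
     4 * (bend p x - slope p x) / rho p x ^+ 2 * (x - p) ord0 i * (x - p) ord0 j).
Proof.
have ds : is_derive x (e i) (slope p) (bend p x * ((rho p x)^-1 * (2 * (x - p) ord0 i))).
  exact: is_derive_comp1 (is_derive_ln_rho p x i) (is_derive_profile2 _ T0).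
have dr := is_derive_rhoV p x i.
have dc : is_derive x (e i) (fun y : V => (y - p) ord0 j) (d i j).
  rewrite (_ : (fun y => _) = (fun y : V => y ord0 j) - cst (p ord0 j)).
    have h := is_derive_coord i j x.
    by apply: is_derive_eq; rewrite subr0.
  by apply/funext => y; rewrite !mxE.
apply: (is_derive_eq (is_deriveM (is_deriveM (is_deriveZ 2 ds) dr) dc)).
rewrite [X in X * _ + _ = _](_ : _ = 2 * slope p x * (rho p x)^-1)//.
rewrite [(2 \*: _) x](_ : _ = 2 * slope p x)//.
have := rho_gt0 p x; move: (rho p x) (slope p x) (bend p x) => r g b r0.
transitivity (2 * g * r^-1 * d i j + (x - p) ord0 j *
  (2 * g * (- (r^-1 * r^-1) * (2 * (x - p) ord0 i)) +
   r^-1 * (2 * (b * (r^-1 * (2 * (x - p) ord0 i)))))) => //.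
by field; rewrite gt_eqF.
Qed.

End bubble.

(** * Curvature of the bubbled metric *)

Lemma sqrt_det_conformal {R : realType} {n : nat} (f : 'rV[R]_n -> R) x :
  Num.sqrt (\det (conformal f x)) = expR (n%:R * f x).
Proof.
rewrite /conformal /eucl scalemx1 det_scalar -expRM_natl -[RHS]ger0_norm ?expR_ge0//.
rewrite -sqrtr_sqr; congr Num.sqrt; rewrite -!expRM_natl; congr expR; ring.
Qed.

Section bubbled_factor.
Context {R : realType} {n N : nat}.
Local Notation V := 'rV[R]_n.
Local Notation e i := (delta_mx ord0 i : V).
Local Notation d i j := ((i == j)%:R : R).
Variables (S T : R) (p : 'I_N -> V).
Hypothesis T0 : 0 < T.
Local Notation a := (expR (- (2 * S)) : R).
Local Notation r k x := (rho a (p k) x).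
(** A bubble vanishes where rho >= 1, so at each point at most one summand is nonzero and the
    curvature is that of a single radial factor. *)
Hypothesis sep : forall i j x, r i x < 1 -> r j x < 1 -> i = j.

Definition factor (x : V) : R := S + \sum_(k < N) bubble T a (p k) x.

Let a0 : 0 < a. Proof. exact: expR_gt0. Qed.

Lemma factor_smooth : smooth factor.
Proof.
apply: (elementary_smooth T0 a0); rewrite /factor.
apply: elementary_add; first exact: elementary_cst.
elim: (index_enum _) => [|k s IH].
  rewrite (_ : (fun x => _) = fun=> 0); first exact: elementary_cst.
  by apply/funext => x; rewrite big_nil.
rewrite (_ : (fun x => _) =
  fun x => bubble T a (p k) x + \sum_(k <- s) bubble T a (p k) x).
  by apply: elementary_add => //; exact: elementary_bubble.
by apply/funext => x; rewrite big_cons.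
Qed.

Let df (i : 'I_n) (x : V) : R :=
  \sum_(k < N) 2 * slope T a (p k) x / r k x * (x - p k) ord0 i.

Let hf (i j : 'I_n) (x : V) : R :=
  \sum_(k < N) (2 * slope T a (p k) x / r k x * d i j +
     4 * (bend T a (p k) x - slope T a (p k) x) / r k x ^+ 2
       * (x - p k) ord0 i * (x - p k) ord0 j).

Let is_derive_factor i x : is_derive x (e i) factor (df i x).
Proof.
have h k := is_derive_bubble T0 a0 (p k) x i.
rewrite (_ : factor = cst S + \sum_(k < N) bubble T a (p k)); last first.
  by apply/funext => y; rewrite /factor /= fct_sumE.
by apply: is_derive_eq; rewrite add0r.
Qed.

Let is_derive_factor2 i j x : is_derive x (e i) (df j) (hf i j x).
Proof.
have h k := is_derive_bubble2 T0 a0 (p k) x i j.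
rewrite (_ : df j = \sum_(k < N) (fun y => 2 * slope T a (p k) y / r k y * (y - p k) ord0 j)).
  exact: is_derive_sum.
by apply/funext => y; rewrite fct_sumE.
Qed.

Lemma bubble_inactive k x : 1 <= r k x ->
  [/\ bubble T a (p k) x = 0, slope T a (p k) x = 0 & bend T a (p k) x = 0].
Proof.
move=> /ln_ge0 r1; rewrite /bubble /slope /bend profile_eq0// /flat ltNge r1 /=.
by rewrite !mulr0 subr0.
Qed.

Lemma active_sum i x (F : 'I_N -> R) : r i x < 1 ->
  (forall k, 1 <= r k x -> F k = 0) -> \sum_(k < N) F k = F i.
Proof.
move=> ri F0; rewrite (bigD1 i)//= big1 ?addr0// => k ki.
apply: F0; rewrite leNgt; apply: contra ki => rk; apply/eqP; exact: sep rk ri.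
Qed.

Lemma factor_active i x : r i x < 1 -> factor x = S + bubble T a (p i) x.
Proof.
move=> ri; rewrite /factor (active_sum ri)// => k.
by move=> /bubble_inactive[].
Qed.

Lemma factor_inactive x : (forall i, 1 <= r i x) -> factor x = S.
Proof.
move=> h; rewrite /factor big1 ?addr0// => k _.
by have [] := bubble_inactive (h k).
Qed.

Lemma factor_ge x : S <= factor x.
Proof. by rewrite lerDl sumr_ge0// => k _; exact: profile_ge0. Qed.

(** A^2 <= B because [slope] lies in [-1, 0] and [bend] is nonnegative. With |z|^2 = rho - a, the
    slopes in 2 A + B |z|^2 cancel up to a nonpositive remainder, leaving at most 4 bend / rho <= 24
    / (T rho). *)
Lemma sigma_minus_active i x : r i x < 1 ->
  sigma_minus (conformal factor) x <= 24 / (T * r i x) * expR (- (2 * factor x)).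
Proof.
move=> ri; have r0 := rho_gt0 a0 (p i) x.
have /andP[g1 g0] := profile_slope (ln (r i x)) T0.
have /andP[b0 b1] := profile_convex (ln (r i x)) T0.
have [si bi] : slope T a (p i) x = T * flat T 1 (ln (r i x)) - flat T 0 (ln (r i x)) /\
  bend T a (p i) x = - T ^+ 2 * flat T 3 (ln (r i x)) by [].
rewrite -si in g1 g0; rewrite -bi in b0 b1.
apply: (@sigma_minus_conformal_le _ _ factor df hf is_derive_factor is_derive_factor2 x (x - p i)
  (2 * slope T a (p i) x / r i x)
  (4 * (bend T a (p i) x - slope T a (p i) x) / r i x ^+ 2)).
- move=> j; apply: (active_sum (F := fun k => 2 * slope T a (p k) x / r k x *
    (x - p k) ord0 j) ri) => k /bubble_inactive[_ -> _].
  by rewrite mulr0 !mul0r.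
- move=> j l; apply: (active_sum (F := fun k => 2 * slope T a (p k) x / r k x * d j l +
     4 * (bend T a (p k) x - slope T a (p k) x) / r k x ^+ 2
       * (x - p k) ord0 j * (x - p k) ord0 l) ri) => k /bubble_inactive[_ -> ->].
  by rewrite subrr !mulr0 !mul0r addr0.
- rewrite expr_div_n ler_pM2r ?invr_gt0 ?exprn_gt0//; nra.
- have q0 : dot (x - p i) (x - p i) = r i x - a by rewrite /rho addrK.
  rewrite q0.
  have -> : 24 / (T * r i x) = 4 * (6 / T) / r i x by field; rewrite !gt_eqF//.
  have [ag ab] : 0 <= a * - slope T a (p i) x /\ 0 <= a * bend T a (p i) x.
    by split; rewrite mulr_ge0 ?oppr_ge0 ?expR_ge0.
  rewrite (_ : _ + _ = (4 * bend T a (p i) x - 4 * (a * bend T a (p i) x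
     + a * - slope T a (p i) x) / r i x) / r i x).
    rewrite ler_pM2r ?invr_gt0//.
    have : 0 <= 4 * (a * bend T a (p i) x + a * - slope T a (p i) x) / r i x.
      by rewrite divr_ge0 ?(ltW r0)// mulr_ge0// addr_ge0.
    lra.
  by field; rewrite gt_eqF.
- by rewrite divr_ge0// mulr_ge0// ltW.
Qed.

Lemma sigma_minus_inactive x : (forall i, 1 <= r i x) ->
  sigma_minus (conformal factor) x = 0.
Proof.
move=> h; apply/eqP; rewrite eq_le sigma_minus_ge0 andbT.
rewrite -[leRHS](mul0r (expR (- (2 * factor x)))).
(* The boundary rho = 1 is included: slope and second derivative of the profile vanish at w = 0, so
   A = B = 0 is a valid choice. *)
apply: (@sigma_minus_conformal_le _ _ factor df hf
  is_derive_factor is_derive_factor2 x 0 0 0) => //.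
- move=> j; rewrite /df mul0r big1// => k _.
  by have [_ -> _] := bubble_inactive (h k); rewrite mulr0 !mul0r.
- move=> j k; rewrite /hf !mul0r addr0 big1// => l _; have [_ -> ->] := bubble_inactive (h l).
  by rewrite subrr !mulr0 !mul0r addr0.
- by rewrite expr0n.
- by rewrite mulr0 mul0r addr0.
Qed.

(** Since rho >= exp (- 2 S) and f >= S, the weight exp (- 2 f) compensates 1 / rho. *)
Lemma sigma_minus_bound x : sigma_minus (conformal factor) x <= 24 / T.
Proof.
have [[i ri]|h] := pselect (exists i, r i x < 1); last first.
  rewrite sigma_minus_inactive ?divr_ge0 ?(ltW T0)// => i.
  by rewrite leNgt; apply/negP => ri; apply: h; exists i.
apply: le_trans (sigma_minus_active ri) _.
have r0 := rho_gt0 a0 (p i) x.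
rewrite (_ : 24 / (T * r i x) * _ = 24 / T * (expR (- (2 * factor x)) / r i x)).
  rewrite ler_piMr ?divr_ge0 ?(ltW T0)// ler_pdivrMr// mul1r.
  apply: (@le_trans _ _ a); last by rewrite /rho lerDr dot_ge0.
  by rewrite ler_expR lerN2 ler_pM2l// factor_ge.
by field; rewrite !gt_eqF.
Qed.

(** * Scale invariant integral of the negative curvature *)

Lemma powR_conformal (k y : R) : 0 <= k ->
  (k * expR (- (2 * y))) `^ (n%:R / 2) * expR (n%:R * y) = k `^ (n%:R / 2).
Proof.
move=> k0; rewrite powRM ?expR_ge0// -expRM -mulrA -expRD.
by rewrite (_ : _ + _ = 0) ?expR0 ?mulr1//; field.
Qed.

Hypothesis n0 : (0 < n)%N.

Let n20 : n%:R / 2 != 0 :> R.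
Proof. by rewrite mulf_neq0 ?invr_eq0// pnatr_eq0 -lt0n. Qed.

(** Decomposition into shells exp (- (k + 1)) < sqrt rho <= exp (- k): on each, rho^(-n/2) is at
    most exp (n (k + 1)), and the shell lies in a cube of half-side exp (- k). Only k <= S occurs,
    as rho >= exp (- 2 S). *)
Lemma curvature_integrand_le x (K : nat) : S < K%:R ->
  sigma_minus (conformal factor) x `^ (n%:R / 2) * Num.sqrt (\det (conformal factor x)) <=
  \sum_(i < N) \sum_(k < K) (24 / T) `^ (n%:R / 2) * expR (n%:R * k.+1%:R) *
    \1_(cube (p i) (expR (- k%:R))) x.
Proof.
move=> SK; rewrite sqrt_det_conformal.
have t0 (i : 'I_N) (k : 'I_K) : 0 <= (24 / T) `^ (n%:R / 2) * expR (n%:R * k.+1%:R) *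
    \1_(cube (p i) (expR (- k%:R))) x :> R.
  by rewrite !mulr_ge0 ?powR_ge0 ?expR_ge0.
have [[i ri]|h] := pselect (exists i, r i x < 1); last first.
  rewrite sigma_minus_inactive ?powR0 ?mul0r//.
    by apply: sumr_ge0 => i _; apply: sumr_ge0.
  by move=> i; rewrite leNgt; apply/negP => ri; apply: h; exists i.
have r0 := rho_gt0 a0 (p i) x.
pose y := - ln (r i x) / 2.
have y0 : 0 <= y by rewrite divr_ge0// oppr_ge0 ln_le0// ltW.
have yS : y <= S.
  have : - (2 * S) <= ln (r i x).
    by rewrite -[leLHS]expRK ler_ln ?posrE// lerDr dot_ge0.
  by rewrite ler_pdivrMr//; lra.
have rE : r i x = expR (- (2 * y)).
  have -> : - (2 * y) = ln (r i x) by rewrite /y; field.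
  by rewrite lnK// posrE.
have /andP[ky yk] := truncn_itv y0.
have kK : (Num.truncn y < K)%N.
  by rewrite -(ltr_nat R); apply: le_lt_trans SK; apply: le_trans yS.
(* Only the term of the bubble and shell containing [x] is kept. *)
rewrite (bigD1 i)//= (bigD1 (Ordinal kK))//= -addrA.
apply: ler_wpDr; first by rewrite addr_ge0// sumr_ge0// => j _; apply: sumr_ge0.
rewrite indicE mem_set => [|j]; last first.
  have : `|(x - p i) ord0 j| <= expR (- (Num.truncn y)%:R).
    rewrite -(@ler_pXn2r _ 2) ?nnegrE ?expR_ge0// -normrX ger0_norm ?sqr_ge0//.
    apply: le_trans (sqr_coord_le_dot _ _) _; rewrite -expRM_natl.
    apply: (@le_trans _ _ (r i x)); first by rewrite lerDl ltW.
    by rewrite rE ler_expR mulrN lerN2 ler_pM2l.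
  by rewrite !mxE ler_distl.
rewrite mulr1.
apply: (@le_trans _ _ ((24 / (T * r i x)) `^ (n%:R / 2))).
  rewrite -(@powR_conformal (24 / _) (factor x)) ?divr_ge0 ?mulr_ge0 ?(ltW T0) ?(ltW r0)//.
  rewrite ler_pM2r ?expR_gt0// ge0_ler_powR ?nnegrE ?sigma_minus_ge0 ?divr_ge0//.
    by rewrite mulr_ge0 ?expR_ge0// divr_ge0// mulr_ge0// ltW.
  exact: sigma_minus_active.
rewrite invfM mulrA powRM ?divr_ge0 ?invr_ge0 ?(ltW T0) ?(ltW r0)//.
apply: ler_wpM2l; first exact: powR_ge0.
rewrite rE -expRN opprK -expRM ler_expR.
rewrite (_ : 2 * y * _ = n%:R * y); last by field.
by rewrite ler_wpM2l// ltW.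
Qed.

(** A shell contributes (24 / T)^(n/2) exp (n (k + 1)) (2 exp (- k))^n, in which k cancels; there
    are N K shells. *)
Lemma curvature_integral_le (K : nat) : S < K%:R ->
  (vol_integral (conformal factor) setT
     (fun x => (sigma_minus (conformal factor) x `^ (n%:R / 2))%R) <=
   ((24 / T) `^ (n%:R / 2) * (2 * expR 1) ^+ n * (N * K)%:R)%:E)%E.
Proof.
move=> SK.
pose c (k : 'I_K) := (24 / T) `^ (n%:R / 2) * expR (n%:R * k.+1%:R).
have c0 k : 0 <= c k by rewrite mulr_ge0 ?powR_ge0 ?expR_ge0.
pose B i (k : 'I_K) := cube (p i) (expR (- k%:R)).
pose F i k : measurableRn R n -> \bar R := fun x => (c k * \1_(B i k) x)%:E.
pose h x := (\sum_(i < N) \sum_(k < K) F i k x)%E.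
have m i k : measurable_fun setT (F i k) by exact: measurable_scaled_cube.
have p0 i k x : (0 <= F i k x)%E.
  by rewrite lee_fin mulr_ge0.
apply: (@le_trans _ _ (\int[lebesgueRn R n]_x h x)%E).
  apply: le_ge0_integral => // x _.
  - by rewrite lee_fin mulr_ge0// ?powR_ge0// sqrtr_ge0.
  - by apply: sume_ge0 => i _; apply: sume_ge0.
  - rewrite /h (eq_bigr _ (fun i _ => sumEFin _ _ _)) sumEFin lee_fin.
    exact: curvature_integrand_le.
rewrite /h ge0_integral_sum//; last first.
- by move=> i x _; apply: sume_ge0.
- by move=> i; apply: emeasurable_sum.
pose C : R := (24 / T) `^ (n%:R / 2) * (2 * expR 1) ^+ n.
rewrite (eq_bigr (fun=> (C *+ K)%:E)) => [|i _].
  rewrite sumEFin sumr_const card_ord -mulrnA lee_fin -/C mulr_natr mulnC.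
  exact: lexx.
rewrite -[K in RHS]card_ord -sumr_const -sumEFin.
rewrite ge0_integral_sum//; apply: eq_bigr => k _.
rewrite /F integral_scaled_cube ?expR_ge0// /c -mulrA; congr ((_ * _)%:E).
rewrite expRM_natl -exprMn; congr (_ ^+ n).
rewrite mulrnAr -expRD -[LHS]mulr_natl; congr (_ * expR _).
by rewrite -natr1; ring.
Qed.

End bubbled_factor.

(** * Distance and completeness *)

Lemma is_derive_segment {R : realType} {n : nat} (x v : 'rV[R]_n) (t : R) :
  is_derive t 1 (fun s : R => x + s *: v) v.
Proof.
have d : is_derive t 1 (fun s : R => s *: v) v.
  split; first exact/diff_derivable.
  by rewrite deriveE // diff_val scale1r.
by rewrite -[v in X in is_derive _ _ _ X]add0r; exact: is_deriveD.
Qed.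

(** The straight segment serves as test curve. *)
Lemma rdist_conformal_le {R : realType} {n : nat} (f : 'rV[R]_n -> R)
    (phi : R -> R) (x y : 'rV[R]_n) :
  (forall t, 0 <= t <= 1 -> expR (f (x + t *: (y - x))) <= phi t) ->
  (rdist (conformal f) x y <=
   \int[lebesgue_measure]_(t in `[0%R, 1%R])
      (Num.sqrt (dot (y - x) (y - x)) * phi t)%:E)%E.
Proof.
move=> hphi; pose c : R -> 'rV[R]_n := fun t => x + t *: (y - x).
have dc (t : R) : is_derive t 1 c (y - x) by exact: is_derive_segment.
have dcE : derive1 c = cst (y - x).
  by apply/funext => t; rewrite derive1E; case: (dc t).
apply: (@le_trans _ _ (curve_length (conformal f) c)).
  apply: ereal_inf_lbound; exists c => //; split.
  - exists [:: 1 : R]; first by rewrite /itv_partition /= ltr01 eqxx.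
    move=> [|//] _; exists c => //; split; first by move=> t; case: (dc t).
    by rewrite dcE; exact: cst_continuous.
  - by rewrite /c scale0r addr0.
  - by rewrite /c scale1r addrC subrK.
apply: le_ge0_integral => // t; rewrite /= ?in_itv/= => ht.
- by rewrite lee_fin mulr_ge0 ?sqrtr_ge0// (le_trans (expR_ge0 _) (hphi _ ht)).
- rewrite lee_fin dcE inner_conformal expRM_natl sqrtrM ?exprn_ge0 ?expR_ge0//.
  rewrite sqrtr_sqr ger0_norm ?expR_ge0// mulrC ler_wpM2l ?sqrtr_ge0//.
  exact: hphi.
Qed.

Lemma itv_partition_disjoint {R : realType} (a b : R) (s : seq R) (j k : nat) (t : R) :
  itv_partition a b s -> (j < size s)%N -> (k < size s)%N ->
  nth b (a :: s) j < t < nth b (a :: s) j.+1 ->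
  nth b (a :: s) k < t < nth b (a :: s) k.+1 -> j = k.
Proof.
move=> [sa _].
have mono i l : (i <= l)%N -> (l < (size s).+1)%N ->
    nth b (a :: s) i <= nth b (a :: s) l.
  rewrite leq_eqVlt => /predU1P[->//|il] ls; apply/ltW/sorted_ltn_nth => //=.
  - exact: lt_trans.
  - by rewrite inE/= (ltn_trans il).
wlog jk : j k / (j <= k)%N.
  move=> h js ks jt kt; have [jk|/ltnW kj] := leqP j k; first exact: h.
  exact/esym/h.
move=> js ks /andP[jt tj] /andP[kt tk].
move: jk; rewrite leq_eqVlt => /predU1P[//|jk].
by have := lt_trans kt tj; rewrite ltNge mono// ltnS ltnW.
Qed.

Lemma telescope_norm {R : realType} (u : nat -> R) (m : nat) :
  `|u m - u 0%N| <= \sum_(k < m) `|u k.+1 - u k|.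
Proof.
rewrite -(big_mkord xpredT (fun k => `|u k.+1 - u k|)).
by rewrite -telescope_sumr//; exact: ler_norm_sum.
Qed.

Lemma C1_coord {R : realType} {n : nat} (c : R -> 'rV[R]_n) (i : 'I_n) :
  C1 c -> [/\ forall t, derivable (fun t => c t ord0 i) t 1,
    continuous (fun t => derive1 c t ord0 i) &
    derive1 (fun t => c t ord0 i) =1 (fun t => derive1 c t ord0 i)].
Proof.
move=> [dc cc]; split=> t.
- by have /derivable_mxP := dc t; exact.
- apply: (continuous_comp (f := derive1 c) (g := fun v : 'rV[R]_n => v ord0 i)); first exact: cc.
  exact: coord_continuous.
- by rewrite !derive1E derive_mx// mxE.
Qed.

(** Fundamental theorem of calculus for one coordinate. The interval is open because a piecewise C^1
    curve shares its derivative with a C^1 piece only in the interior. *)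
Lemma coord_displacement_le {R : realType} {n : nat} (c : R -> 'rV[R]_n) (i : 'I_n) (a b : R) :
  C1 c -> a < b ->
  (`|c b ord0 i - c a ord0 i|%:E <=
   \int[lebesgue_measure]_(t in `]a, b[) `|derive1 c t ord0 i|%:E)%E.
Proof.
move=> /(C1_coord i)[dc cc dcE] ab.
pose g : R -> R := fun t => derive1 c t ord0 i.
have cw (h : R -> R) : continuous h -> {within `[a, b], continuous h}.
  by move=> ch; apply: continuous_subspaceT.
have cci : continuous (fun t : R => c t ord0 i).
  by move=> t; exact/differentiable_continuous/derivable1_diffP/dc.
have dF : derivable_oo_LRcontinuous (fun t : R => c t ord0 i) a b.
  split=> //.
  - exact/cvg_at_right_filter/cci.
  - exact/cvg_at_left_filter/cci.
have mg A : measurable_fun A g by apply: measurable_funTS; exact: continuous_measurable_fun.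
rewrite -(@integral_itv_bndoo _ _ _ _ true false); last first.
  by apply/measurable_EFinP/measurableT_comp => //.
apply: (@le_trans _ _ `|\int[lebesgue_measure]_(t in `[a, b]) (g t)%:E|%E).
  by rewrite (continuous_FTC2 ab (cw _ cc) dF)// => t _; exact: dcE.
by apply: le_abse_integral => //; apply/measurable_EFinP; exact: mg.
Qed.

(** For f >= 0 the metric dominates the Euclidean one, so the length of a curve bounds the variation
    of each coordinate. *)
Lemma rdist_conformal_ge {R : realType} {n : nat} (f : 'rV[R]_n -> R) (x y : 'rV[R]_n) i :
  (forall z, 0 <= f z) ->
  (`|(y - x) ord0 i|%:E <= rdist (conformal f) x y)%E.
Proof.
move=> f0; apply: le_ereal_inf_tmp => _ [c [[s sP cs] c0 c1] <-].
pose b k := nth 1 (0 :: s) k.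
have /choice[g gP] : forall k, exists g : R -> 'rV[R]_n, (k < size s)%N ->
    C1 g /\ {in `[b k, b k.+1], c =1 g}.
  move=> k; have [/cs[g gC cg]|_] := ltnP k (size s); first by exists g.
  by exists (cst 0).
(* At each time at most one [F k] is nonzero, so their sum stays below the length integrand, while
   their integrals bound the displacements over the pieces. *)
pose F k : R -> \bar R := (fun t => `|derive1 (g k) t ord0 i|%:E) \_ `]b k, b k.+1[.
have F0 k t : (0 <= F k t)%E by apply: erestrict_ge0.
have bb k : (k < size s)%N -> b k < b k.+1.
  case: sP => sa _ ks; apply: sorted_ltn_nth => //; first exact: lt_trans.
  by rewrite inE ltnW.
have mF k : (k < size s)%N -> measurable_fun setT (F k).
  move=> ks; apply/(measurable_restrictT _ _).1 => //.
  have [/(C1_coord i)[_ cg _] _] := gP k ks.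
  apply/measurable_EFinP/measurableT_comp => //; apply: measurable_funTS.
  exact: continuous_measurable_fun.
apply: (@le_trans _ _ (\int[lebesgue_measure]_t \sum_(k < size s) F k t)%E).
  rewrite ge0_integral_sum//; last by move=> k; exact: mF.
  apply: (@le_trans _ _ (\sum_(k < size s) `|c (b k.+1) ord0 i - c (b k) ord0 i|)%:E).
    have := telescope_norm (fun k => c (b k) ord0 i) (size s).
    by rewrite {1}/b (itv_partition_nth_size _ sP) {1}/b /= c0 c1 lee_fin !mxE.
  rewrite -sumEFin; apply: lee_sum => k _.
  rewrite -integral_mkcond; have [gC cg] := gP k (ltn_ord k).
  rewrite !cg ?in_itv/= ?lexx ?(ltW (bb k (ltn_ord k)))//.
  exact: (coord_displacement_le i gC (bb k (ltn_ord k))).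
rewrite /curve_length [leRHS]integral_mkcond.
apply: le_ge0_integral => // t _; first exact: sume_ge0.
  by apply: erestrict_ge0 => u _; rewrite lee_fin sqrtr_ge0.
(* Break points and times outside [0, 1] lie in no open piece; the sum is 0 there, whatever the
   value of [derive1 c]. *)
have [[k kt]|nk] := pselect (exists k : 'I_(size s), b k < t < b k.+1); last first.
  rewrite big1 => [|k _]; first by apply: erestrict_ge0 => u _; rewrite lee_fin sqrtr_ge0.
  rewrite /F patchE ifF//; apply/negP; rewrite inE/= in_itv/= => kt.
  by apply: nk; exists k.
rewrite (bigD1 k)//= big1 ?adde0 => [|j jk]; last first.
  rewrite /F patchE ifF//; apply/negP; rewrite inE/= in_itv/= => jt.
  have kj := itv_partition_disjoint sP (ltn_ord k) (ltn_ord j) kt jt.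
  by move: jk; rewrite -(inj_eq val_inj)/= kj eqxx.
have t01 : 0 <= t <= 1.
  case/andP: (kt) => kt1 kt2; apply/andP; split.
    by apply: le_trans _ (ltW kt1); apply: itv_partition_nth_ge sP; rewrite ltnS ltnW.
  by apply: le_trans (ltW kt2) _; apply: itv_partition_nth_le sP; rewrite ltnS.
rewrite /F !patchE !mem_set/= ?in_itv//=.
rewrite lee_fin inner_conformal.
have -> : derive1 c t = derive1 (g k) t.
  have [_ cg] := gP k (ltn_ord k); rewrite !derive1E; apply: near_eq_derive.
  have : \forall z \near t, z \in `]b k, b k.+1[.
    by apply: near_in_itvoo; rewrite in_itv.
  by apply: filterS => z zk; apply: cg; exact: subset_itv_oo_cc.
rewrite -sqrtr_sqr ler_wsqrtr//; apply: le_trans (sqr_coord_le_dot _ _) _.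
by rewrite ler_peMl ?dot_ge0// -expR0 ler_expR mulr_ge0.
Qed.

Lemma sqrt_dot_le {R : realType} {n : nat} (v : 'rV[R]_n) (e : R) :
  (forall i, `|v ord0 i| <= e) -> 0 <= e -> Num.sqrt (dot v v) <= n%:R * e.
Proof.
move=> ve e0; rewrite -[leRHS]ger0_norm ?mulr_ge0// -sqrtr_sqr ler_wsqrtr//.
apply: (@le_trans _ _ (\sum_(i < n) e ^+ 2)).
  apply: ler_sum => i _; rewrite -expr2 -real_normK ?num_real//.
  by rewrite ler_pXn2r ?nnegrE.
rewrite sumr_const card_ord exprMn -[leLHS]mulr_natl ler_wpM2r ?sqr_ge0//.
rewrite -natrX ler_nat; case: n {v ve} => // n; exact: leq_pmulr.
Qed.

Lemma rdist_conformal_le_bounded {R : realType} {n : nat} (f : 'rV[R]_n -> R)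
    (M : R) (x y : 'rV[R]_n) : (forall z, f z <= M) ->
  (rdist (conformal f) x y <= (Num.sqrt (dot (y - x) (y - x)) * expR M)%:E)%E.
Proof.
move=> fM.
apply: le_trans; first apply: (@rdist_conformal_le _ _ _ (cst (expR M))).
  by move=> t _; rewrite ler_expR.
rewrite [X in (integral _ _ X <= _)%E](_ : _ =
  cst (Num.sqrt (dot (y - x) (y - x)) * expR M)%:E)//.
by rewrite integral_cst//= lebesgue_measure_itv/= lte_fin ltr01 sube0 mule1.
Qed.

(** Bounds on f make the distance comparable with the Euclidean one: a Cauchy sequence converges
    coordinatewise, and the vector of limits is its limit in the metric. *)
Lemma complete_conformal {R : realType} {n : nat} (f : 'rV[R]_n -> R) (M : R) :
  (forall z, 0 <= f z) -> (forall z, f z <= M) -> complete_metric (conformal f).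
Proof.
move=> f0 fM u uC.
have cu i : cvgn (fun k => u k ord0 i).
  apply/cauchy_cvgP/cauchy_exP => e e0; have [N hN] := uC e e0.
  exists (u N ord0 i).
  suff : \forall k \near \oo, ball (u N ord0 i) e (u k ord0 i) by [].
  near=> k; rewrite /ball/= distrC.
  have := rdist_conformal_ge (u N) (u k) i f0; rewrite !mxE -lte_fin => h.
  apply: le_lt_trans h (hN _ _ _ _) => //.
  by near: k; exact: nbhs_infty_ge.
pose l : 'rV[R]_n := \row_i limn (fun k => u k ord0 i).
exists l => e e0.
(* The factor [n.+1] in place of [n] makes the final inequality strict. *)
pose d : R := e / (expR M * n.+1%:R).
have d0 : 0 < d by rewrite divr_gt0// mulr_gt0 ?expR_gt0.
have : \forall k \near \oo, forall i, `|l ord0 i - u k ord0 i| < d.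
  apply: filter_forall => i; rewrite mxE.
  by have /cvgrPdist_lt/(_ _ d0) := cu i.
move=> [N _ hN]; exists N => k Nk.
apply: le_lt_trans (rdist_conformal_le_bounded _ _ fM) _; rewrite lte_fin.
have dE : d * n.+1%:R * expR M = e.
  by rewrite /d; field; rewrite !gt_eqF ?expR_gt0.
rewrite -dE ltr_pM2r ?expR_gt0//.
apply: le_lt_trans (@sqrt_dot_le _ _ _ d _ (ltW d0)) _ => [i|].
  by have /= := hN k Nk i; rewrite !mxE => /ltW.
by rewrite mulrC ltr_pM2l// ltr_nat.
Unshelve. all: by end_near. Qed.

(** * Crossing a bubble *)

Section profile_bounds.
Context {R : realType}.
Variable S : R.
Local Notation T := (2 * S * ln (4 / 3)).

(* This T makes exp (T / w) equal to 3/4 at the center of a bubble, w = - 2 S: a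
   value above 1/2 is what makes the bubble larger than the flat part around it. *)
Lemma ln43_gt0 : 0 < ln (4 / 3) :> R.
Proof. by rewrite ln_gt0// ltr_pdivlMr// mul1r ltr_nat. Qed.

Lemma ln43_le1 : ln (4 / 3) <= 1 :> R.
Proof.
have := @le_ln1Dx R (1 / 3); rewrite (_ : 1 + 1 / 3 = 4 / 3); last by field.
by move=> /(_ _)/le_trans; apply; lra.
Qed.

Lemma expR_ln43 : expR (- ln (4 / 3)) = 3 / 4 :> R.
Proof. by rewrite expRN lnK ?posrE ?divr_gt0// invf_div. Qed.

(** For - 2 S <= w < 0 one has T / w <= - ln (4/3), so the profile is at most - 3/4 w. At w = ln rho
    the right-hand side is 1 + rho^(-3/4). *)
Lemma profile_le (w : R) : - (2 * S) <= w ->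
  expR (profile T w) <= 1 + expR (- (3 / 4 * w)).
Proof.
move=> Sw; have [w0|w0] := leP 0 w.
  by rewrite profile_eq0// expR0 lerDl expR_ge0.
apply: (@le_trans _ _ (expR (- (3 / 4 * w)))); last by rewrite lerDr.
rewrite ler_expR /profile /flat w0 expr0 mul1r lerN2 [3 / 4 * w]mulrC ler_nM2l//.
rewrite -expR_ln43 ler_expR ler_ndivrMr// mulNr -mulrN [leRHS]mulrC.
by rewrite ler_pM2l ?ln43_gt0//; lra.
Qed.

(** With W = - w, exp (T / w) is 3/4 exp (- ln (4/3) (2 S - W) / W). The bounds exp y >= 1 + y and
    ln (4/3) <= 1 then make the profile at least 3/4 (2 W - 2 S), where W >= 2 S - d. *)
Lemma profile_ge (w d : R) : - (2 * S) <= w -> w <= - (2 * S) + d ->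
  3 / 2 * S - 3 / 2 * d <= profile T w.
Proof.
move=> Sw wd; have [w0|w0] := leP 0 w.
  by rewrite profile_eq0//; lra.
pose W := - w; have W0 : 0 < W by rewrite oppr_gt0.
have -> : profile T w = W * expR (T / w).
  by rewrite /profile /flat w0 expr0 mul1r /W mulNr.
have -> : T / w = - ln (4 / 3) - ln (4 / 3) * (2 * S - W) / W.
  by rewrite /W; field; rewrite lt_eqF.
rewrite expRD expR_ln43.
apply: (@le_trans _ _ (W * (3 / 4 * (1 - ln (4 / 3) * (2 * S - W) / W)))).
  rewrite (_ : W * _ = 3 / 4 * (W - ln (4 / 3) * (2 * S - W))); last first.
    by field; rewrite gt_eqF.
  have : ln (4 / 3) * (2 * S - W) <= 1 * (2 * S - W).
    by rewrite ler_wpM2r ?ln43_le1// /W; lra.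
  by rewrite mul1r /W; lra.
by rewrite ler_pM2l// ler_pM2l ?divr_gt0// expR_ge1Dx.
Qed.

End profile_bounds.

Section path_integral.
Context {R : realType}.
Variables (S H : R).
Hypothesis H0 : 0 < H.
Local Notation eps := (expR (- S)).

(* On the segment from the origin to a bubble, u = H (1 - t) bounds the distance to
   its center from below; the length element is at most
   exp S (1 + (u^2 + eps^2)^(-3/4)) <= exp S (1 + 2 (u + eps)^(-3/2)). *)
Definition speed (t : R) : R :=
  expR S * (1 + 2 * expR (- (3 / 2 * ln (H * (1 - t) + eps)))).

(** An antiderivative of [speed] on t <= 1. *)
Definition arclength (t : R) : R :=
  expR S * (t + 4 / H * expR (- (1 / 2 * ln (H * (1 - t) + eps)))).

Let pos (t : R) : t <= 1 -> 0 < H * (1 - t) + eps.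
Proof. by move=> t1; rewrite ltr_wpDl ?expR_gt0// mulr_ge0 ?subr_ge0// ltW. Qed.

Let is_derive_expln (k t : R) : t <= 1 ->
  is_derive t 1 (fun t => expR (- (k * ln (H * (1 - t) + eps))))
    (k * H * expR (- ((k + 1) * ln (H * (1 - t) + eps)))).
Proof.
move=> /pos u0; set u := (X in expR (- (_ * ln X))) in u0 *.
have du : is_derive t 1 (fun t => H * (1 - t) + eps) (- H).
  rewrite (_ : (fun _ => _) = H *: (cst 1 - id) + cst eps) //.
  by apply: is_derive_eq; rewrite addr0 sub0r scalerN /GRing.scale/= mulr1.
have dl : is_derive t 1 (fun t => - (k * ln (H * (1 - t) + eps))) (k * H / u).
  rewrite (_ : (fun _ => _) = (- k) *: (fun t => ln (H * (1 - t) + eps))); last first.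
    by apply/funext => s; rewrite -mulNr.
  apply: (is_derive_eq (is_deriveZ (- k) (is_derive_comp1 du (is_derive1_ln u0)))).
  by rewrite /GRing.scale/= -/u; ring.
apply: (is_derive_eq (is_derive_comp1 dl (is_derive_expR _))).
have eu : expR (- ln u) = u^-1 by rewrite expRN lnK ?posrE.
by rewrite -/u mulrDl mul1r opprD expRD eu; ring.
Qed.

Let is_derive_affine (k l : R) (g h : R -> R) (t dg dh : R) :
  is_derive t 1 g dg -> is_derive t 1 h dh ->
  is_derive t 1 (fun t => k * (g t + l * h t)) (k * (dg + l * dh)).
Proof. by move=> hg hh; exact: (is_deriveZ k (is_deriveD hg (is_deriveZ l hh))). Qed.

Lemma is_derive_arclength (t : R) : t <= 1 -> is_derive t 1 arclength (speed t).
Proof.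
move=> t1; apply: (is_derive_eq (is_derive_affine (expR S) (4 / H)
  (is_derive_id t 1) (is_derive_expln (1 / 2) t1))).
rewrite /speed (_ : 1 / 2 + 1 = 3 / 2); last by field.
by field; rewrite gt_eqF.
Qed.

Lemma continuous_speed (t : R) : t <= 1 -> {for t, continuous speed}.
Proof.
move=> t1; have [+ _] := is_derive_affine (expR S) 2 (is_derive_cst (1 : R) t 1)
  (is_derive_expln (3 / 2) t1).
by move=> /derivable1_diffP/differentiable_continuous.
Qed.

Lemma within_continuous_speed : {within `[0, 1], continuous speed}.
Proof.
apply: continuous_in_subspaceT => t; rewrite inE/= in_itv/= => /andP[_ t1].
exact: continuous_speed.
Qed.

Lemma integral_speed : (\int[lebesgue_measure]_(t in `[0%R, 1%R]) (speed t)%:E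
  <= (expR S + 4 / H * expR (3 / 2 * S))%:E)%E.
Proof.
have ca (t : R) : t <= 1 -> {for t, continuous arclength}.
  by move=> /is_derive_arclength[+ _] => /derivable1_diffP/differentiable_continuous.
rewrite (@continuous_FTC2 _ _ arclength)//.
(* At t = 1 the argument of [ln] is exp (- S), whose power -1/2 gives exp (S / 2). The value at t =
   0 is nonnegative and is dropped. *)
- rewrite -EFinB lee_fin /arclength subrr mulr0 add0r expRK.
  rewrite (_ : 3 / 2 * S = S + - (1 / 2 * - S)); last by field.
  rewrite [in leRHS]expRD mulrDr mulr1 add0r -subr_ge0.
  set E := expR (- (_ * ln _)).
  rewrite (_ : _ - _ = expR S * (4 / H * E)); last by ring.
  by rewrite !mulr_ge0 ?expR_ge0// invr_ge0 ltW.
- exact: within_continuous_speed.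
- split.
  + by move=> t; rewrite in_itv/= => /andP[_ /ltW /is_derive_arclength[]].
  + exact/cvg_at_right_filter/ca.
  + exact/cvg_at_left_filter/ca.
- move=> t; rewrite in_itv/= => /andP[_ /ltW /is_derive_arclength[_ <-]].
  by rewrite derive1E.
Qed.

(** With u = H (1 - t) + eps one has u^2 <= 2 rho, so rho^(-3/4) <= 2^(3/4) u^(-3/2) <= 2
    u^(-3/2). *)
Lemma speed_ge (rho t : R) : t <= 1 -> (H * (1 - t)) ^+ 2 + expR (- (2 * S)) <= rho ->
  expR S * (1 + expR (- (3 / 4 * ln rho))) <= speed t.
Proof.
move=> t1 hr; rewrite /speed ler_pM2l ?expR_gt0// lerD2l.
have u0 := pos t1; set u := _ + eps in u0 *.
have r0 : 0 < rho by apply: lt_le_trans hr; rewrite ltr_wpDl ?sqr_ge0 ?expR_gt0.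
have : u ^+ 2 <= 2 * rho.
  have e2 : expR (- (2 * S)) = eps ^+ 2 by rewrite -expRM_natl mulrN.
  move: hr (sqr_ge0 (H * (1 - t) - eps)); rewrite e2 /u.
  by move: (H * (1 - t)) eps => y z; nra.
rewrite -ler_ln ?posrE ?exprn_gt0 ?mulr_gt0// lnXn// lnM ?posrE// -[X in X <= _]mulr_natl => h.
have l2 : 3 / 4 * ln 2 <= ln 2 :> R.
  by rewrite ler_piMl ?ln_ge0 ?ler1n// ler_pdivrMr// mul1r ler_nat.
rewrite (_ : 2 * expR _ = expR (ln 2 + - (3 / 2 * ln u))); last first.
  by rewrite expRD lnK ?posrE.
rewrite ler_expR.
by move: h l2; move: (ln 2) (ln u) (ln rho) => A B C; lra.
Qed.

End path_integral.

(** * The bubbled space *)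

Section centers.
Context {R : realType} {n N : nat}.
Local Notation V := 'rV[R]_n.
Variables (S : R) (i0 i1 : 'I_n).
Hypotheses (S0 : 0 < S) (i01 : i0 != i1).
Local Notation T := (2 * S * ln (4 / 3)).
Local Notation a := (expR (- (2 * S)) : R).
Local Notation eps := (expR (- S) : R).
Local Notation H := (6 * N%:R + 1 : R).

(* The centers lie on a line at height H ~ N above the origin, so a segment from
   the origin that ends near one bubble misses the others. *)
Definition center (k : 'I_N) : V :=
  \row_j if j == i0 then 6 * k%:R else if j == i1 then H else 0.

Local Notation f := (factor S T center).

Let H0 : 0 < H. Proof. by rewrite ltr_wpDl// mulr_ge0. Qed.

Let T0 : 0 < T. Proof. by rewrite mulr_gt0 ?ln43_gt0// mulr_gt0. Qed.

Lemma rho_lt1_coord p (x : V) j : rho a p x < 1 -> `|x ord0 j - p ord0 j| < 1.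
Proof.
move=> r1; have /le_lt_trans/(_ r1) : (x ord0 j - p ord0 j) ^+ 2 <= rho a p x.
  apply: (@le_trans _ _ (dot (x - p) (x - p))); last by rewrite lerDl expR_ge0.
  by have := sqr_coord_le_dot (x - p) j; rewrite !mxE.
by rewrite -real_normK ?num_real// expr_lt1.
Qed.

(** The spacing 6 exceeds twice the tolerance 2. Segments use that much room: 1 for the radius of a
    bubble and 1 for the shift along the segment. *)
Lemma close_centers (k l : 'I_N) (y : R) :
  `|y - 6 * k%:R| < 2 -> `|y - 6 * l%:R| < 2 -> k = l.
Proof.
move=> yk yl; apply/val_inj => /=.
move: yk yl; rewrite !ltr_norml => yk yl.
by have [kl|kl|//] := ltngtP k l; exfalso; move: kl; rewrite -(ler_nat R) -natr1; lra.
Qed.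

Lemma center_sep (k l : 'I_N) (x : V) :
  rho a (center k) x < 1 -> rho a (center l) x < 1 -> k = l.
Proof.
move=> /(rho_lt1_coord i0) + /(rho_lt1_coord i0); rewrite !mxE eqxx /= => xk xl.
by apply: (@close_centers _ _ (x ord0 i0)); [apply: lt_trans xk _|apply: lt_trans xl _];
  rewrite ltr1n.
Qed.

(** A cube of side exp (- S) hanging below the center. Its points have height at most H, so the
    point t y of a segment stays at vertical distance at least H (1 - t) from the center. *)
Definition core (k : 'I_N) : set (measurableRn R n) :=
  cube (center k - (eps / 2) *: delta_mx ord0 i1) (eps / 2).

Lemma eps_le1 : eps <= 1.
Proof. by rewrite -expR0 ler_expR oppr_le0 ltW. Qed.

Lemma core_coord k (y : V) : core k y ->
  [/\ `|y ord0 i0 - 6 * k%:R| <= 1, H - eps <= y ord0 i1 <= H,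
      forall j, `|y ord0 j - center k ord0 j| <= eps & forall j, `|y ord0 j| <= H].
Proof.
move=> yk; have e1 := eps_le1; have e0 := expR_gt0 (- S).
have c0 := yk i0; have c1 := yk i1.
rewrite !mxE eqxx !eqxx/= (negbTE i01) mulr0 subr0 in c0.
rewrite !mxE eqxx !eqxx/= eq_sym (negbTE i01) mulr1 in c1.
have N0 : 0 <= N%:R :> R by [].
have kN : k%:R + 1 <= N%:R :> R by rewrite natr1 ler_nat.
have k0 : 0 <= k%:R :> R by [].
split.
- by rewrite ler_norml; lra.
- lra.
- move=> j; have := yk j; rewrite !mxE eqxx/=.
  by case: (eqVneq j i0); case: (eqVneq j i1); rewrite ?mulr1 ?mulr0 ler_norml; lra.
- move=> j; have := yk j; rewrite !mxE eqxx/= ler_norml.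
  by case: (eqVneq j i0); case: (eqVneq j i1); rewrite ?mulr1 ?mulr0; lra.
Qed.

Lemma core_disjoint k l (y : V) : core k y -> core l y -> k = l.
Proof.
move=> /core_coord[yk _ _ _] /core_coord[yl _ _ _].
by apply: (@close_centers _ _ (y ord0 i0));
  [apply: le_lt_trans yk _|apply: le_lt_trans yl _]; rewrite ltr1n.
Qed.

Lemma factor_segment_le k (y : V) t : core k y -> 0 <= t <= 1 ->
  expR (f (0 + t *: (y - 0))) <= speed S H t.
Proof.
move=> /core_coord[y0 /andP[y1 y1'] _ yH] /andP[t0 t1]; rewrite add0r subr0.
set x := t *: y.
have [[l rl]|nl] := pselect (exists l, rho a (center l) x < 1); last first.
  rewrite factor_inactive => [|l]; last first.
    by rewrite leNgt; apply/negP => rl; apply: nl; exists l.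
  by rewrite /speed ler_peMr ?expR_ge0// lerDl mulr_ge0 ?expR_ge0.
have N0 : 0 <= N%:R :> R by [].
(* Closeness to center [l] in height forces H (1 - t) < 1; since |y_i0| <= H, the [i0] coordinates
   of [t *: y] and [y] then differ by less than 1. *)
have lk : l = k.
  have := rho_lt1_coord i0 rl; have := rho_lt1_coord i1 rl.
  rewrite !mxE !eqxx eq_sym (negbTE i01) => x1 x0.
  apply: (@close_centers _ _ (y ord0 i0)) => //; last by apply: le_lt_trans y0 _; rewrite ltr1n.
  have Ht : H * (1 - t) < 1.
    move: x1; rewrite ltr_norml => /andP[+ _].
    have : t * y ord0 i1 <= t * H by rewrite ler_wpM2l.
    lra.
  have : `|(1 - t) * y ord0 i0| <= H * (1 - t).
    by rewrite normrM ger0_norm ?subr_ge0// mulrC ler_wpM2r ?subr_ge0.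
  have -> : y ord0 i0 - 6 * l%:R = (t * y ord0 i0 - 6 * l%:R) + (1 - t) * y ord0 i0 by ring.
  by move=> ?; apply: le_lt_trans (ler_normD _ _) _; lra.
subst l; rewrite (factor_active _ center_sep rl) expRD.
have r0 : 0 < rho a (center k) x by rewrite rho_gt0 ?expR_gt0.
apply: le_trans (@speed_ge _ S _ H0 (rho a (center k) x) _ t1 _); last first.
  apply: (@le_trans _ _ ((x - center k) ord0 i1 ^+ 2 + a)).
    rewrite lerD2r !mxE eq_sym (negbTE i01) eqxx /= -[leRHS]sqrrN opprB.
    rewrite ler_pXn2r ?nnegrE ?mulr_ge0 ?subr_ge0 ?(ltW H0)//.
    - by rewrite mulrBr mulr1 lerD2l lerN2 mulrC ler_wpM2r.
    - by apply: le_trans (ler_wpM2l t0 y1') _; rewrite ler_piMl// ltW.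
  by rewrite /rho lerD2r sqr_coord_le_dot.
rewrite ler_pM2l ?expR_gt0//; apply: profile_le => //.
by rewrite -[leLHS]expRK ler_ln ?posrE ?expR_gt0// lerDr dot_ge0.
Qed.

(** The segment has length at most n H, and this H cancels the 1 / H in [integral_speed]: the cost
    of crossing a neck does not grow with N. *)
Lemma rdist_core k (y : V) : core k y ->
  (rdist (conformal f) 0 y <= (n%:R * (H * expR S + 4 * expR (3 / 2 * S)))%:E)%E.
Proof.
move=> yk; apply: le_trans.
  by apply: (@rdist_conformal_le _ _ _ (speed S H)) => t; exact: factor_segment_le yk.
rewrite subr0; set l := Num.sqrt _.
have lH : l <= n%:R * H.
  by have [_ _ _ yH] := core_coord yk; apply: sqrt_dot_le => //; exact: ltW.
under eq_integral do rewrite EFinM.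
rewrite ge0_integralZl//; last 3 first.
- apply/measurable_EFinP; apply: subspace_continuous_measurable_fun => //.
  exact: within_continuous_speed.
- by move=> t _; rewrite lee_fin mulr_ge0 ?addr_ge0 ?mulr_ge0 ?expR_ge0.
- by rewrite lee_fin sqrtr_ge0.
apply: le_trans; first apply: lee_wpmul2l (integral_speed S H0).
  by rewrite lee_fin sqrtr_ge0.
rewrite -EFinM lee_fin.
apply: (@le_trans _ _ (n%:R * H * (expR S + 4 / H * expR (3 / 2 * S)))).
  by rewrite ler_wpM2r// addr_ge0 ?mulr_ge0 ?expR_ge0// invr_ge0 ltW.
by rewrite le_eqVlt; apply/orP; left; apply/eqP; field; rewrite gt_eqF.
Qed.

(** On the core rho <= (n + 1) exp (- 2 S), so [profile_ge] applies with d = ln (n + 1). *)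
Lemma factor_core k (y : V) : core k y ->
  5 / 2 * S - 3 / 2 * ln n.+1%:R <= f y.
Proof.
move=> /core_coord[_ _ yk _].
have r0 : 0 < rho a (center k) y by rewrite rho_gt0 ?expR_gt0.
have rle : rho a (center k) y <= expR (- (2 * S)) * n.+1%:R.
  rewrite /rho -[n.+1%:R]natr1 mulrDr mulr1 lerD2r.
  rewrite mulr_natr -[X in _ *+ X]card_ord -sumr_const; apply: ler_sum => j _.
  rewrite -expr2 -real_normK ?num_real// -mulrN expRM_natl.
  by rewrite ler_pXn2r ?nnegrE ?expR_ge0// !mxE; have := yk j; rewrite mxE.
have rge : - (2 * S) <= ln (rho a (center k) y).
  by rewrite -[leLHS]expRK ler_ln ?posrE ?expR_gt0// lerDr dot_ge0.
have rle' : ln (rho a (center k) y) <= - (2 * S) + ln n.+1%:R.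
  rewrite -[X in X + _]expRK -lnM ?posrE ?expR_gt0//.
  by rewrite ler_ln ?posrE ?mulr_gt0 ?expR_gt0.
apply: (@le_trans _ _ (S + bubble T a (center k) y)).
  by have := profile_ge rge rle'; rewrite /bubble; lra.
rewrite /factor lerD2l (bigD1 k)//= lerDl sumr_ge0// => l _.
exact: profile_ge0.
Qed.

(** The cores are disjoint and lie in the ball; each has Euclidean volume exp (- n S) and density at
    least exp (n (5/2 S - 3/2 ln (n + 1))). *)
Lemma volume_ball_ge (r : R) :
  n%:R * (H * expR S + 4 * expR (3 / 2 * S)) < r ->
  ((N%:R * expR (n%:R * (3 / 2 * (S - ln n.+1%:R))))%:E <=
    volume (conformal f) (geodesic_ball (conformal f) 0 r))%E.
Proof.
move=> hr; pose c : R := expR (n%:R * (5 / 2 * S - 3 / 2 * ln n.+1%:R)).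
have c0 : 0 <= c by exact: expR_ge0.
pose B k : measurableRn R n -> \bar R := fun y => (c * \1_(core k) y)%:E.
have B0 k y : (0 <= B k y)%E by rewrite lee_fin mulr_ge0.
have e0 : 0 <= eps / 2 by rewrite divr_ge0 ?expR_ge0.
apply: (@le_trans _ _ (\int[lebesgueRn R n]_y \sum_(k < N) B k y)%E).
  rewrite ge0_integral_sum//; last by move=> k; exact: measurable_scaled_cube.
  rewrite (eq_bigr (fun=> (expR (n%:R * (3 / 2 * (S - ln n.+1%:R))))%:E)) => [|k _].
    by rewrite sumEFin sumr_const card_ord mulr_natl.
  have e2 : (eps / 2) *+ 2 = eps by rewrite -mulr_natr divfK ?pnatr_eq0.
  rewrite integral_scaled_cube// e2 -expRM_natl -expRD.
  by congr ((expR _)%:E); field.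
rewrite /volume /vol_integral [leRHS]integral_mkcond.
have g0 y : (0 <= ((fun z : V => (1 * Num.sqrt (\det (conformal f z)))%:E) \_
    (geodesic_ball (conformal f) 0 r)) y)%E.
  by apply: erestrict_ge0 => z _; rewrite lee_fin mul1r sqrtr_ge0.
apply: le_ge0_integral => // y _; first by apply: sume_ge0.
have [[k yk]|nk] := pselect (exists k, core k y); last first.
  rewrite big1 => [|k _]; first exact: g0.
  by rewrite /B indicE memNset ?mulr0// => yk; apply: nk; exists k.
rewrite (bigD1 k)//= big1 ?adde0 => [|l lk]; last first.
  rewrite /B indicE memNset ?mulr0// => yl; move/eqP: lk; apply.
  exact: core_disjoint yl yk.
rewrite patchE mem_set; last first.
  by apply: le_lt_trans (rdist_core yk) _; rewrite lte_fin.
rewrite /B indicE mem_set// mulr1 mul1r sqrt_det_conformal lee_fin ler_expR.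
by rewrite ler_wpM2l//; exact: factor_core yk.
Qed.

End centers.

(** A crude bound, enough for completeness: exp (T / w) <= 1 and w >= - 2 S. *)
Lemma factor_le {R : realType} {n N : nat} (S T : R) (p : 'I_N -> 'rV[R]_n) x :
  0 <= S -> 0 < T -> factor S T p x <= S + N%:R * (2 * S).
Proof.
move=> S0 T0; rewrite lerD2l.
apply: (@le_trans _ _ (\sum_(k < N) 2 * S)).
  apply: ler_sum => k _; rewrite /bubble /profile /flat.
  set w := ln _; have Sw : - (2 * S) <= w.
    by rewrite -[leLHS]expRK ler_ln ?posrE ?rho_gt0 ?expR_gt0// lerDr dot_ge0.
  case: ifPn => w0; last by rewrite mulr0 oppr0 mulr_ge0.
  rewrite expr0 mul1r -mulNr; apply: (@le_trans _ _ (- w)); last by rewrite lerNl.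
  rewrite ler_piMr ?oppr_ge0 ?(ltW w0)// -expR0 ler_expR.
  by rewrite ltW// pmulr_rlt0// invr_lt0.
by rewrite sumr_const card_ord -[leLHS]mulr_natl.
Qed.

(** The case without bubbles. The half-side b satisfies n b exp S = r / 2, which puts the cube
    inside the ball. *)
Lemma volume_ball_cst {R : realType} {n : nat} (f : 'rV[R]_n -> R) (S r : R) :
  (0 < n)%N -> (forall x, f x = S) -> 0 < r ->
  (((r / n%:R) ^+ n)%:E <= volume (conformal f) (geodesic_ball (conformal f) 0 r))%E.
Proof.
move=> n0 fS r0; pose b := r / n%:R * expR (- S) / 2.
have nR : 0 < n%:R :> R by rewrite ltr0n.
have b0 : 0 <= b by rewrite divr_ge0// mulr_ge0 ?expR_ge0// divr_ge0 ?(ltW r0).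
rewrite (_ : ((r / n%:R) ^+ n)%:E =
    (\int[lebesgueRn R n]_y (expR (n%:R * S) * \1_(cube 0 b) y)%:E)%E); last first.
  rewrite integral_scaled_cube ?expR_ge0// expRM_natl -exprMn; congr ((_ ^+ _)%:E).
  rewrite -mulr_natr /b expRN; field; rewrite !gt_eqF ?expR_gt0//.
rewrite /volume /vol_integral [leRHS]integral_mkcond.
have g0 y : (0 <= ((fun z : 'rV[R]_n => (1 * Num.sqrt (\det (conformal f z)))%:E) \_
    (geodesic_ball (conformal f) 0 r)) y)%E.
  by apply: erestrict_ge0 => z _; rewrite lee_fin mul1r sqrtr_ge0.
apply: le_ge0_integral => // y _.
have [yb|nb] := pselect (cube 0 b y); last by rewrite indicE memNset// mulr0 g0.
rewrite patchE mem_set; last first.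
  apply: le_lt_trans (@rdist_conformal_le_bounded _ _ f S 0 y _) _ => [z|].
    by rewrite fS.
  rewrite lte_fin subr0; apply: (@le_lt_trans _ _ (n%:R * b * expR S)).
    rewrite ler_pM2r ?expR_gt0//; apply: sqrt_dot_le => // i.
    by have := yb i; rewrite mxE sub0r add0r ler_norml.
  rewrite (_ : _ * _ = r / 2); first by rewrite ltr_pdivrMr// ltr_pMr// ltr1n.
  by rewrite /b expRN; field; rewrite !gt_eqF ?expR_gt0.
by rewrite indicE mem_set// mulr1 mul1r sqrt_det_conformal fS.
Qed.

(** * Numerical inequalities *)

Section constants.
Context {R : realType}.
Implicit Types S : R.

Lemma expr_le_expR S k : (0 < k)%N -> 0 <= S ->
  S ^+ k <= k`!%:R * 2 ^+ k * expR (S / 2).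
Proof.
case: k => // k _ S0; have S2 : 0 <= S / 2 by rewrite divr_ge0.
have := expR_ge_pow k S2; rewrite expr_div_n ler_pdivrMr ?exprn_gt0//.
by move=> /le_trans; apply; rewrite mulrAC.
Qed.

Lemma powRB1 S x : 0 < S -> S `^ (x - 1) * S = S `^ x.
Proof.
move=> S0; rewrite -[X in _ * X]powRr1 ?(ltW S0)// -powRD ?subrK//.
by rewrite (gt_eqF S0) implybT.
Qed.

Lemma powRVl S x : 0 < S -> S^-1 `^ x = (S `^ x)^-1.
Proof.
move=> S0; apply: (@mulIf _ (S `^ x)); first by rewrite gt_eqF ?powR_gt0.
by rewrite -powRM ?invr_ge0 ?(ltW S0)// !mulVf ?powR1// gt_eqF ?powR_gt0.
Qed.

(** S / 2 is the average of the two lower bounds 1 and S - 1. *)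
Lemma truncn_ge_half S : 1 <= S -> S / 2 <= (Num.truncn S)%:R.
Proof.
move=> S1; have /andP[_ h] := truncn_itv (le_trans ler01 S1).
have : 1 <= (Num.truncn S)%:R :> R by rewrite ler1n truncn_gt0.
by move: h; rewrite -natr1; lra.
Qed.

End constants.

(** * Choice of the parameters and of the constant *)

Unset Implicit Arguments.

Theorem theoremD (R : realType) (n : nat) (hn : (3 <= n)%N) :
  exists2 C : R, 0 < C & forall r : R, 3 < r ->
    exists2 f : 'rV[R]_n -> R, smooth f &
      [/\ complete_metric (conformal f),
          forall x, sigma_minus (conformal f) x <= C,
          (vol_integral (conformal f) setT
             (fun x => (sigma_minus (conformal f) x `^ (n%:R / 2))%R) <= C%:E)%E &
          ((C^-1 * r ^+ n * ln r `^ (n%:R / 2 - 1))%:E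
             <= volume (conformal f) (geodesic_ball (conformal f) 0 r))%E].
Proof.
have n0 : (0 < n)%N by exact: leq_trans hn.
pose i0 : 'I_n := Ordinal n0; pose i1 : 'I_n := Ordinal (leq_trans (isT : 1 < 3)%N hn).
have i01 : i0 != i1 by [].
pose m : R := n%:R / 2; pose c : R := ln (4 / 3).
have c0 : 0 < c by exact: ln43_gt0.
have m1 : 1 <= m by rewrite ler_pdivlMr// mul1r ler_nat (leq_trans _ hn).
(* [D] is chosen so that H <= D exp (S / 2) for the number of bubbles used; exp K exceeds n (D + 4),
   which puts the cores in the ball of radius r = exp (K + 3/2 S). *)
pose D : R := 7 * (n`!%:R * 2 ^+ n).
pose K : R := ln (n%:R * (D + 4) + 1).
have D0 : 0 <= D by rewrite mulr_ge0// mulr_ge0// exprn_ge0.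
have nD0 : 0 <= n%:R * (D + 4) by rewrite mulr_ge0// addr_ge0.
have K0 : 0 <= K by rewrite ln_ge0// lerDr.
have eK : expR K = n%:R * (D + 4) + 1 by rewrite lnK// posrE ltr_wpDl.
(* [C1] serves the curvature, [C2] its integral, [C3] and [C4] the volume for large and for small
   [r]. *)
pose C1 : R := 12 / c.
pose C2 : R := 2 * (12 / c) `^ m * (2 * expR 1) ^+ n.
pose C3 : R := 2 * expR (n%:R * (K + 3 / 2 * ln n.+1%:R)) * (3 / 2 + K) `^ (m - 1).
pose C4 : R := n%:R ^+ n * (3 / 2 + K) `^ (m - 1).
have C10 : 0 <= C1 by rewrite divr_ge0// ltW.
have C20 : 0 <= C2 by rewrite mulr_ge0 ?exprn_ge0 ?mulr_ge0 ?powR_ge0 ?expR_ge0.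
have K1 : 0 < 3 / 2 + K by rewrite ltr_wpDr.
have C30 : 0 < C3 by rewrite mulr_gt0 ?powR_gt0// mulr_gt0 ?expR_gt0.
have C40 : 0 < C4 by rewrite mulr_gt0 ?powR_gt0// exprn_gt0// ltr0n.
exists (C1 + C2 + C3 + C4); first by rewrite addr_gt0// ltr_wpDl// addr_ge0.
have CC1 : C1 <= C1 + C2 + C3 + C4 by lra.
have CC2 : C2 <= C1 + C2 + C3 + C4 by lra.
have CC3 : C3 <= C1 + C2 + C3 + C4 by lra.
have CC4 : C4 <= C1 + C2 + C3 + C4 by lra.
move: (C1 + C2 + C3 + C4) CC1 CC2 CC3 CC4 => C CC1 CC2 CC3 CC4 r r3.
have C0 : 0 < C by exact: lt_le_trans CC4.
have r0 : 0 < r by exact: lt_trans r3.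
have lnr0 : 0 < ln r by rewrite ln_gt0// (lt_trans _ r3)// ltr1n.
(* Only the volume bound involves [r]; the other claims follow from S >= 1 and N <= S^(m - 1). *)
have reduce (S : R) N : 1 <= S -> (N%:R <= S `^ (m - 1)) ->
    (forall S0 : 0 < S, let f := factor S (2 * S * c) (@center R n N i0 i1) in
      ((C^-1 * r ^+ n * ln r `^ (m - 1))%:E
             <= volume (conformal f) (geodesic_ball (conformal f) 0 r))%E) ->
  exists2 f : 'rV[R]_n -> R, smooth f &
      [/\ complete_metric (conformal f),
          forall x, sigma_minus (conformal f) x <= C,
          (vol_integral (conformal f) setT
             (fun x => (sigma_minus (conformal f) x `^ m)%R) <= C%:E)%E &
          ((C^-1 * r ^+ n * ln r `^ (m - 1))%:E
             <= volume (conformal f) (geodesic_ball (conformal f) 0 r))%E].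
  move=> S1 NS hv; have S0 : 0 < S by exact: lt_le_trans S1.
  have T0 : 0 < 2 * S * c by rewrite mulr_gt0// mulr_gt0.
  have T24 : 24 / (2 * S * c) = C1 / S by rewrite /C1; field; rewrite !gt_eqF.
  exists (factor S (2 * S * c) (@center R n N i0 i1)); first exact: factor_smooth.
  split; last exact: hv.
  - apply: (@complete_conformal _ _ _ (S + N%:R * (2 * S))) => z.
      exact: le_trans (ltW S0) (factor_ge _ _ _ _).
    by apply: factor_le => //; exact: ltW.
  - move=> x; apply: le_trans (sigma_minus_bound T0 (@center_sep _ _ _ _ _ _) x) _.
    by rewrite T24; apply: le_trans CC1; rewrite ler_pdivrMr// ler_peMr.
  (* With floor S + 1 <= 2 S shells per bubble there are at most 2 S^m shells, which cancels the
     S^(-m) of (C1 / S)^m. *)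
  - have /andP[_ SK] := truncn_itv (ltW S0).
    apply: le_trans (curvature_integral_le T0 (@center_sep _ _ _ _ _ _) n0 SK) _.
    rewrite lee_fin; apply: le_trans CC2; rewrite T24 powRM ?invr_ge0 ?(ltW S0)//.
    rewrite powRVl// natrM -natr1.
    have tS : (Num.truncn S)%:R <= S by have /andP[] := truncn_itv (ltW S0).
    have p0 : 0 < S `^ m by rewrite powR_gt0.
    have : N%:R * ((Num.truncn S)%:R + 1) <= 2 * S `^ m.
      rewrite -(powRB1 _ S0); apply: (@le_trans _ _ (S `^ (m - 1) * (2 * S))).
        by apply: ler_pM => //; lra.
      by rewrite mulrCA.
    rewrite -ler_pdivrMr// [X in X <= _]mulrC => h.
    rewrite (_ : _ * _ = C1 `^ m * (2 * expR 1) ^+ n *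
      ((S `^ m)^-1 * (N%:R * ((Num.truncn S)%:R + 1)))); last by ring.
    rewrite /C2 (_ : 2 * _ * _ = C1 `^ m * (2 * expR 1) ^+ n * 2); last by rewrite /C1; ring.
    apply: ler_wpM2l => //; apply: mulr_ge0; first exact: powR_ge0.
    by apply: exprn_ge0; rewrite mulr_ge0 ?expR_ge0.
(* Below the threshold no bubble is placed, and the bounded power of ln r is absorbed in [C4]. *)
have [small|big] := ltP (ln r) (3 / 2 + K).
  apply: (reduce 1 0%N) => //; first exact: powR_ge0.
  move=> _; apply: le_trans (@volume_ball_cst _ _ _ 1 r n0 _ r0); last first.
    by move=> x; rewrite /factor big_ord0 addr0.
  rewrite lee_fin -mulrA ler_pdivrMl//.
  have nn : 0 < n%:R ^+ n :> R by rewrite exprn_gt0// ltr0n.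
  have rn : 0 <= r ^+ n by rewrite exprn_ge0// ltW.
  have P : ln r `^ (m - 1) <= (3 / 2 + K) `^ (m - 1).
    by rewrite ge0_ler_powR ?nnegrE ?subr_ge0 ?(ltW lnr0) ?(ltW K1)// ltW.
  apply: (@le_trans _ _ (C4 * (r / n%:R) ^+ n)); last first.
    by rewrite ler_wpM2r// exprn_ge0// divr_ge0// ltW.
  rewrite /C4 expr_div_n (_ : _ * (_ / _) = r ^+ n * (3 / 2 + K) `^ (m - 1)).
    by rewrite ler_wpM2l.
  by field; rewrite gt_eqF.
(* The solution of r = exp (K + 3/2 S); the threshold on ln r amounts to S >= 1. *)
pose S := 2 / 3 * (ln r - K).
have S1 : 1 <= S by rewrite /S; lra.
have S0 : 0 < S by exact: lt_le_trans S1.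
have rE : r = expR (K + 3 / 2 * S).
  by rewrite (_ : K + _ = ln r) ?lnK ?posrE// /S; field.
pose Q := S `^ (m - 1).
have Q1 : 1 <= Q by rewrite -[leLHS](powRr0 S) ler_powR// subr_ge0.
pose N := Num.truncn Q.
have NQ : N%:R <= Q by have /andP[] := truncn_itv (le_trans ler01 Q1).
apply: (reduce S N) => // f.
have H_le : 6 * N%:R + 1 <= D * expR (S / 2).
  (* A natural power of S is bounded by exp (S / 2) through [expr_le_expR], and m - 1 <= n. *)
  have QS : Q <= S ^+ n.
    rewrite -powR_mulrn ?(ltW S0)// /Q ler_powR// /m.
    have : 0 <= n%:R :> R by [].
    lra.
  have := expr_le_expR n0 (ltW S0); rewrite /D.
  move: (n`!%:R * 2 ^+ n) => d; nra.
apply: (le_trans _ (volume_ball_ge S0 i01 _)); last first.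
  (* H exp S <= D exp (3/2 S); the strict inequality comes from the summand 1 in exp K. *)
  have e0 := expR_gt0 (3 / 2 * S).
  rewrite rE expRD eK; apply: (@le_lt_trans _ _ (n%:R * (D + 4) * expR (3 / 2 * S))).
    rewrite -[leRHS]mulrA ler_wpM2l// [leRHS]mulrDl lerD2r.
    rewrite (_ : 3 / 2 * S = S / 2 + S); last by field.
    by rewrite expRD mulrA ler_wpM2r ?expR_ge0.
  by rewrite ltr_pM2r// ltrDl.
rewrite lee_fin -mulrA ler_pdivrMl//.
have P : ln r `^ (m - 1) <= (3 / 2 + K) `^ (m - 1) * Q.
  have lS : ln r <= (3 / 2 + K) * S.
    by rewrite rE expRK; have := ler_wpM2l K0 S1; lra.
  rewrite -powRM ?(ltW K1) ?(ltW S0)//; apply: ge0_ler_powR => //.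
  - by rewrite subr_ge0.
  - by rewrite nnegrE ltW.
  - by rewrite nnegrE mulr_ge0 ?(ltW K1) ?(ltW S0).
have rn : 0 <= r ^+ n by rewrite exprn_ge0// ltW.
apply: (le_trans (ler_wpM2l rn P)).
apply: (@le_trans _ _ (C3 * (N%:R * expR (n%:R * (3 / 2 * (S - ln n.+1%:R)))))); last first.
  by rewrite ler_wpM2r// mulr_ge0 ?expR_ge0.
rewrite {1}rE -expRM_natl (_ : n%:R * (K + 3 / 2 * S) =
  n%:R * (K + 3 / 2 * ln n.+1%:R) + n%:R * (3 / 2 * (S - ln n.+1%:R))); last by ring.
(* Rounding Q down to N costs at most a factor 2, which [C3] contains. *)
rewrite expRD /C3; have := truncn_ge_half Q1; rewrite -/N.
have := expR_gt0 (n%:R * (K + 3 / 2 * ln n.+1%:R)).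
have := expR_gt0 (n%:R * (3 / 2 * (S - ln n.+1%:R))).
have := powR_ge0 (3 / 2 + K) (m - 1).
move: (expR (n%:R * (3 / 2 * (S - ln n.+1%:R))))
  (expR (n%:R * (K + 3 / 2 * ln n.+1%:R))) ((3 / 2 + K) `^ (m - 1)) => A B P' P0 A0 B0 h.
rewrite (_ : 2 * B * P' * (N%:R * A) = B * A * P' * (2 * N%:R)); last by ring.
rewrite [leLHS]mulrA ler_wpM2l//; last by lra.
by rewrite mulr_ge0// mulr_ge0// ltW.
Qed.
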